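(* Let $n>2$, $K$ a field, and let $I$ be the ideal of $(n-1)$-minors of the generic $n\times n$ matrix $X=(x_{ij})$ in $K[x_{ij}]$. Set $V=\{x_{ij}:0\le j-i\le1\}\cup\{x_{n1}\}$ and $W=\{x_{ij}:x_{ij}\notin V\}$, and let $Y$ be the matrix obtained from $X$ by replacing $x_{ij}$ with $0$ whenever $x_{ij}\in W$. Let $\succ$ be any reverse lexicographic term order such that $x_{ij}\succ x_{hk}$ whenever $x_{ij}\in V$ and $x_{hk}\in W$. Then $\operatorname{in}_\succ(I)$ is a squarefree monomial ideal with the same (graded) Betti numbers as $I$, and the core of the associated initial complex is isomorphic to the boundary complex of the cyclic polytope with $2n$ vertices in $\mathbb R^{2n-4}$. More precisely, $\operatorname{in}_\succ(I)$ is the specialization of $I$ by the regular sequence $W$; that is, $\operatorname{in}_\succ(I)$ is the ideal of $(n-1)$-minors of $Y$.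
   Context: The initial complex of a squarefree monomial ideal is the simplicial complex whose Stanley–Reisner ideal it is; its core is its restriction to the vertices not lying in every facet. *)

(* Defs.v *)
From HB Require Import structures.
From mathcomp Require Import all_boot all_order all_algebra.
From mathcomp Require Import mpoly.
Unset Implicit Arguments.
Unset Strict Implicit.
Unset Printing Implicit Defensive.
Import Order.TTheory GRing.Theory Num.Theory.
Local Open Scope ring_scope.

Section Defs.
Variable K : fieldType.
Variable n : nat.

Notation S := {mpoly K[n * n]}.
Notation var := ('I_n * 'I_n)%type.
Notation monom := 'X_{1..n * n}.

Definition vidx (v : var) : 'I_(n * n) := mxvec_index v.1 v.2.
Definition xvar (v : var) : S := 'X_(vidx v).

Definition generic_mx : 'M[S]_n := \matrix_(i, j) xvar (i, j).

Definition ideal_gen (s : seq S) : S -> Prop :=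
  fun p => exists c : 'I_(size s) -> S, p = \sum_(k < size s) c k * s`_k.

Definition incr (f : {ffun 'I_n.-1 -> 'I_n}) : bool :=
  [forall a : 'I_n.-1, forall b : 'I_n.-1, (a < b)%N ==> (f a < f b)%N].

Definition minor_of (M : 'M[S]_n)
    (p : {ffun 'I_n.-1 -> 'I_n} * {ffun 'I_n.-1 -> 'I_n}) : S :=
  \det (mxsub (fun k => p.1 k) (fun k => p.2 k) M).

Definition minors (M : 'M[S]_n) : seq S :=
  map (minor_of M) (enum [pred p : {ffun 'I_n.-1 -> 'I_n} * {ffun 'I_n.-1 -> 'I_n}
               | incr p.1 && incr p.2]).

Definition inV (v : var) : bool :=
  (((v.1 : nat) <= v.2)%N && ((v.2 : nat) <= (v.1 : nat).+1)%N)
  || (((v.1 : nat) == n.-1) && ((v.2 : nat) == 0%N)).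

Definition Wvars : seq S := [seq xvar v | v <- enum [pred v : var | ~~ inV v]].

Definition Ymx : 'M[S]_n := \matrix_(i, j) (if inV (i, j) then xvar (i, j) else 0).

Definition regular_seq_mod (G ws : seq S) : Prop :=
  (forall k : nat, (k < size ws)%N -> forall g : S,
      ideal_gen (G ++ take k ws) (g * ws`_k) -> ideal_gen (G ++ take k ws) g)
  /\ ~ ideal_gen (G ++ ws) 1.

(* --- reverse lexicographic term order ---
   r : var -> nat injective ranks the variables: r v < r w means x_v > x_w.
   Degree reverse lexicographic order: m > m' iff deg m > deg m', or the
   degrees agree and, at the smallest variable where the exponents differ,
   m has the smaller exponent. *)
Definition revlex_gt (r : var -> nat) (m m' : monom) : Prop :=
  (mdeg m' < mdeg m)%N \/
  (mdeg m = mdeg m' /\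
   exists v : var, (m (vidx v) < m' (vidx v))%N /\
     forall w : var, (r v < r w)%N -> m (vidx w) = m' (vidx w)).

Definition is_lm (r : var -> nat) (f : S) (m : monom) : Prop :=
  m \in msupp f /\ forall m', m' \in msupp f -> m' <> m -> revlex_gt r m m'.

Definition initial_ideal (r : var -> nat) (J : S -> Prop) : S -> Prop :=
  fun p => exists (L : nat) (f : 'I_L -> S) (m : 'I_L -> monom) (c : 'I_L -> S),
    (forall k, J (f k) /\ is_lm r (f k) (m k)) /\
    p = \sum_(k < L) c k * 'X_[m k].

Definition sqfree (m : monom) : bool := [forall i, (m i <= 1)%N].

Definition sqfree_monomial_ideal (J : S -> Prop) : Prop :=
  exists s : seq monom, all sqfree s /\
    forall p, J p <-> ideal_gen [seq 'X_[m] | m <- s] p.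

(* --- graded Betti numbers via minimal graded free resolutions ---
   a i = list of the degrees of the basis elements of F_i (so
   F_i = (+)_k S(-(a i)_k)); g = the generators of J (the map F_0 -> J);
   D i : F_(i+1) -> F_i as a matrix acting on column vectors. *)
Definition is_homog (d : nat) (p : S) : Prop :=
  forall m, m \in msupp p -> mdeg m = d.

Definition min_graded_res (J : S -> Prop) (a : nat -> seq nat)
    (g : 'rV[S]_(size (a 0%N)))
    (D : forall i : nat, 'M[S]_(size (a i), size (a i.+1))) : Prop :=
  (forall k, J (g 0 k) /\ is_homog (nth 0%N (a 0%N) k) (g 0 k)) /\
  (forall p, J p <-> exists u : 'cV[S]_(size (a 0%N)), p = (g *m u) 0 0) /\
  (forall v : 'cV[S]_(size (a 0%N)), g *m v = 0 <-> exists u, v = D 0%N *m u) /\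
  (forall i (v : 'cV[S]_(size (a i.+1))), D i *m v = 0 <-> exists u, v = D i.+1 *m u) /\
  (forall i k l, D i k l = 0 \/
          ((nth 0%N (a i) k <= nth 0%N (a i.+1) l)%N /\
           is_homog (nth 0%N (a i.+1) l - nth 0%N (a i) k) (D i k l))) /\
  (forall i k l, (D i k l)@_0%MM = 0) /\
  (exists L, forall i, (L < i)%N -> a i = [::]).

Definition betti (a : nat -> seq nat) (i j : nat) : nat := count_mem j (a i).

Definition same_graded_betti (J1 J2 : S -> Prop) : Prop :=
  exists a1 g1 D1 a2 g2 D2,
    min_graded_res J1 a1 g1 D1 /\ min_graded_res J2 a2 g2 D2 /\
    forall i j, betti a1 i j = betti a2 i j.

Definition sqmon (F : {set var}) : S := \prod_(v in F) xvar v.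
Definition sr_face (J : S -> Prop) (F : {set var}) : Prop := ~ J (sqmon F).
Definition sr_facet (J : S -> Prop) (F : {set var}) : Prop :=
  sr_face J F /\ forall G, sr_face J G -> F \subset G -> G = F.
Definition core_vertex (J : S -> Prop) (v : var) : Prop :=
  sr_face J [set v] /\ exists F, sr_facet J F /\ v \notin F.
Definition core_face (J : S -> Prop) (F : {set var}) : Prop :=
  sr_face J F /\ forall v, v \in F -> core_vertex J v.

End Defs.

(* --- boundary complex of the cyclic polytope C(N, d) ---
   vertices p_i = (t_i, t_i^2, ..., t_i^d) with t_i = i+1, i < N;
   a vertex set F is a face of the boundary complex iff some nonzero linear
   functional c attains its maximum b over the vertices exactly on F. *)
Definition cyc_bd_face (R : realFieldType) (N d : nat) (F : {set 'I_N}) : Prop :=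
  exists (c : 'rV[R]_d) (b : R), c != 0 /\
    forall i : 'I_N,
      (i \in F -> \sum_(k < d) c 0 k * ((i : nat).+1%:R) ^+ (k : nat).+1 = b) /\
      (i \notin F -> \sum_(k < d) c 0 k * ((i : nat).+1%:R) ^+ (k : nat).+1 < b).

Definition core_iso_cyclic (K : fieldType) (n : nat) (R : realFieldType)
    (J : {mpoly K[n * n]} -> Prop) : Prop :=
  exists phi : 'I_n * 'I_n -> 'I_(2 * n),
    (forall v w, core_vertex K n J v -> core_vertex K n J w -> phi v = phi w -> v = w) /\
    (forall i : 'I_(2 * n), exists2 v, core_vertex K n J v & phi v = i) /\
    (forall F : {set 'I_n * 'I_n}, (forall v, v \in F -> core_vertex K n J v) ->
       (core_face K n J F <-> cyc_bd_face R (2 * n) (2 * n - 4) (phi @: F))).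

(* Main.v *)
Require Import Defs.
From HB Require Import structures.
From mathcomp Require Import all_boot all_order all_algebra.
From mathcomp Require Import mpoly.
From mathcomp Require Import perm ring zify.

(* The ideal of (n-1)-minors of a matrix X is resolved by the Gulliksen-Negard
   complex.  Every element f = tr (adj X N) of this ideal annihilates the homology of
   the complex, through homotopies built from the derivative of adj at X in the
   direction N; so if the ideal contains a regular sequence of length 4, the complex
   is exact (induction modulo longer and longer parts of the sequence).

   For X = Y, a cyclic bidiagonal matrix, the minors are, up to sign, the n^2 products
   of n - 1 pairwise non-adjacent variables of a 2n-cycle.  With e' the product of all
   variables but one and e the elementary symmetric function of degree n - 1, the
   regular sequence is e', e in the diagonal variables and e', e in the others.

   Exactness passes from Y to X, one variable of W at a time: modulo w a cycle is a
   boundary, so it differs from a boundary by w times a cycle of smaller degree.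
   The syzygies of the minors of Y thus lift, which makes W a regular sequence modulo I
   and, for a reverse lexicographic order with W smallest, gives in(I) = I(Y).  The two
   ideals are resolved by complexes of the same shape.

   Finally, sets of vertices of a cyclic polytope in even dimension 2n - 4 that lie on
   no proper face are those containing n - 1 pairwise non-adjacent vertices of the
   2n-cycle (Gale evenness), which are the generators of I(Y). *)

Set Implicit Arguments.
Unset Strict Implicit.
Unset Printing Implicit Defensive.
Import Order.TTheory GRing.Theory Num.Theory.
Local Open Scope ring_scope.

(** * Derivative of the adjugate *)

(** Differentiating [X *m \adj X = (\det X)%:M] along [N] yields a homotopy [h] with
    [d h + h d = f]. If [z] is a cycle modulo [J], then [h z] is a cycle modulo [J + (f)]. Exactness
    there gives [h z = d w + f z'], so [f z = f d z'] modulo [J], and a regular [f] cancels. Each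
    position thus costs one regular element: three for the positions needed and one for injectivity
    at the left end.

    The homotopy identities are proved by cancelling [X], which is impossible modulo [J]; hence the
    ambient ring is a domain with [\det X] nonzero, and [J] a mere predicate on it.

    A regular sequence is visible for Y because its entries form two disjoint families of variables.
    In the passage to the generic matrix, lifted chains have no degree bound; truncating them by
    degree, which is compatible with homogeneous differentials, makes the induction on the degree
    possible. *)

Section AdjugateDerivative.
Variables (A : comNzRingType) (n : nat).
Implicit Types (X N : 'M[A]_n).

Definition line_mx X N : 'M[{poly A}]_n := map_mx polyC X + 'X *: map_mx polyC N.

(** Summing over unit directions, instead of taking a coefficient on [line_mx X N], makes linearity
    in [N] immediate; along a unit direction the determinant is affine in the parameter. *)
Definition dadj X N : 'M[A]_n :=
  \sum_q \sum_p N q p *: map_mx (coefp 1) (\adj (line_mx X (delta_mx q p))).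

Lemma adj_line_coef0 X N : map_mx (coefp 0) (\adj (line_mx X N)) = \adj X.
Proof.
have E0 (p : {poly A}) : coefp 0 p = horner_eval 0 p by rewrite /= /horner_eval horner_coef0.
have EM (M : 'M[{poly A}]_n) : map_mx (coefp 0) M = map_mx (horner_eval 0) M.
  by apply/matrixP => i j; rewrite !mxE -E0.
rewrite EM map_mx_adj; congr (\adj _); apply/matrixP=> i j.
by rewrite !mxE /= /horner_eval !hornerE.
Qed.

(** The parameter sits in a single entry of row [q], so the cofactors along that row do not involve
    it. *)
Lemma det_line_delta X q p :
  \det (line_mx X (delta_mx q p)) = (\det X)%:P + 'X * (\adj X p q)%:P.
Proof.
have cofE j : cofactor (line_mx X (delta_mx q p)) q j = (cofactor X q j)%:P.
  rewrite /cofactor polyCM rmorphXn rmorphN1; congr (_ * _).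
  rewrite -det_map_mx; congr (\det _); apply/matrixP => a b; rewrite !mxE.
  by rewrite [_ == q]eq_sym (negbTE (neq_lift _ _)) mulr0 addr0.
rewrite (expand_det_row _ q) (expand_det_row X q).
under eq_bigr => j _ do rewrite cofE !mxE eqxx /= mulrDl -polyCM -mulrA -polyCM.
rewrite big_split /= -rmorph_sum; congr (_ + _).
rewrite (bigD1 p) //= eqxx mul1r big1 ?addr0 ?mxE //.
by move=> j /negbTE ->; rewrite mul0r mulr0.
Qed.

Lemma mxtrace_adj_delta X q p : \tr (\adj X *m delta_mx q p) = \adj X p q.
Proof.
rewrite /mxtrace (bigD1 p) //= big1 ?addr0.
  by rewrite mxE (bigD1 q) //= !mxE !eqxx mulr1 big1 ?addr0 // => k /negbTE kq; rewrite !mxE kq mulr0.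
move=> k /negbTE kp; rewrite mxE big1 // => l _.
by rewrite !mxE kp andbF mulr0.
Qed.

Lemma mulmx_dadj_delta X q p :
  X *m map_mx (coefp 1) (\adj (line_mx X (delta_mx q p))) + delta_mx q p *m \adj X
  = (\adj X p q)%:M.
Proof.
have := mul_mx_adj (line_mx X (delta_mx q p)).
rewrite det_line_delta => /(congr1 (map_mx (coefp 1))) => E.
transitivity (map_mx (coefp 1) (line_mx X (delta_mx q p) *m \adj (line_mx X (delta_mx q p)))); last first.
  rewrite E; apply/matrixP=> i j; rewrite !mxE /= coefMn coefD coefC coefXM coefC /=.
  by rewrite add0r.
rewrite /line_mx mulmxDl -/(line_mx _ _) map_mxD.
congr (_ + _); apply/matrixP=> i j; rewrite !mxE /= coef_sum; apply: eq_bigr => k _.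
  by rewrite !mxE coefCM.
by rewrite -(adj_line_coef0 X (delta_mx q p)) [map_mx _ _ k j]mxE !mxE -mulrA coefXM coefCM.
Qed.

Lemma dadj_delta_mulmx X q p :
  map_mx (coefp 1) (\adj (line_mx X (delta_mx q p))) *m X + \adj X *m delta_mx q p
  = (\adj X p q)%:M.
Proof.
have := mul_adj_mx (line_mx X (delta_mx q p)).
rewrite det_line_delta => /(congr1 (map_mx (coefp 1))) => E.
transitivity (map_mx (coefp 1) (\adj (line_mx X (delta_mx q p)) *m line_mx X (delta_mx q p))); last first.
  rewrite E; apply/matrixP=> i j; rewrite !mxE /= coefMn coefD coefC coefXM coefC /=.
  by rewrite add0r.
rewrite {3}/line_mx mulmxDr map_mxD.
congr (_ + _); apply/matrixP=> i j; rewrite !mxE /= coef_sum; apply: eq_bigr => k _.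
  by rewrite !mxE coefMC.
rewrite -(adj_line_coef0 X (delta_mx q p)) [map_mx _ _ i k]mxE !mxE mulrCA coefXM coefMC.
by [].
Qed.

Lemma mulmx_dadj X N : X *m dadj X N + N *m \adj X = (\tr (\adj X *m N))%:M.
Proof.
rewrite /dadj {2 3}(matrix_sum_delta N) !mulmx_sumr !mulmx_suml -big_split /=.
rewrite (linear_sum (@mxtrace A n)) (raddf_sum (@scalar_mx A n)) /=; apply: eq_bigr => q _.
rewrite !mulmx_sumr !mulmx_suml -big_split (linear_sum (@mxtrace A n)) (raddf_sum (@scalar_mx A n)) /=; apply: eq_bigr => p _.
rewrite -!scalemxAr -!scalemxAl -scalerDr mulmx_dadj_delta.
by rewrite linearZ /= mxtrace_adj_delta scale_scalar_mx.
Qed.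

Lemma dadj_mulmx X N : dadj X N *m X + \adj X *m N = (\tr (\adj X *m N))%:M.
Proof.
rewrite /dadj {2 3}(matrix_sum_delta N) !mulmx_sumr !mulmx_suml -big_split /=.
rewrite (linear_sum (@mxtrace A n)) (raddf_sum (@scalar_mx A n)) /=; apply: eq_bigr => q _.
rewrite !mulmx_sumr !mulmx_suml -big_split (linear_sum (@mxtrace A n)) (raddf_sum (@scalar_mx A n)) /=; apply: eq_bigr => p _.
rewrite -!scalemxAr -!scalemxAl -scalerDr dadj_delta_mulmx.
by rewrite linearZ /= mxtrace_adj_delta scale_scalar_mx.
Qed.

Lemma dadjB X M N : dadj X (M - N) = dadj X M - dadj X N.
Proof.
rewrite /dadj -sumrB; apply: eq_bigr => q _; rewrite -sumrB; apply: eq_bigr => p _.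
by rewrite !mxE scalerBl.
Qed.

End AdjugateDerivative.

Section DomainAdjugate.
Variables (A : idomainType) (n : nat) (X : 'M[A]_n).
Hypothesis detX : \det X != 0.
Implicit Types N Z P : 'M[A]_n.

Lemma mulmx_detI : injective (mulmx X : 'M_n -> 'M_n).
Proof.
move=> M N /(congr1 (mulmx (\adj X))); rewrite !mulmxA mul_adj_mx !mul_scalar_mx.
by move/scalemx_inj=> /(_ detX).
Qed.

(** The derivative of [adj ((1 + t P) X) = adj X adj (1 + t P)], where [adj (1 + t P)] starts with
    [1 + t (tr P - P)]. The proof multiplies by [X] and cancels it; [dadj_mull] is the mirror
    image. *)
Lemma dadj_mulr P : dadj X (P *m X) = \adj X *m ((\tr P)%:M - P).
Proof.
apply: mulmx_detI; rewrite mulmxA mul_mx_adj mul_scalar_mx scalerBr scale_scalar_mx.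
have := mulmx_dadj X (P *m X).
rewrite -mulmxA mul_mx_adj mulmxA mxtrace_mulC mulmxA mul_mx_adj mul_scalar_mx mxtraceZ.
by rewrite mul_mx_scalar => <-; rewrite addrK.
Qed.

Lemma dadj_mull P : dadj X (X *m P) = ((\tr P)%:M - P) *m \adj X.
Proof.
apply: mulmx_detI.
have := mulmx_dadj X (X *m P).
rewrite [\adj X *m (X *m P)]mulmxA mul_adj_mx mul_scalar_mx mxtraceZ => E.
rewrite mulmxA mulmxBr mul_mx_scalar mulmxBl -scalemxAl mul_mx_adj.
by rewrite scale_scalar_mx mulrC -E addrK.
Qed.

(** Both sides are the second derivative of the determinant at [X] in the directions [Z] and [N].
    Multiplied by [\det X], it becomes visibly symmetric. *)
Lemma mxtrace_dadjC N Z : \tr (Z *m dadj X N) = \tr (dadj X Z *m N).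
Proof.
suff H M P : \det X * \tr (P *m dadj X M) =
   \tr (\adj X *m M) * \tr (\adj X *m P) - \tr (\adj X *m M *m (\adj X *m P)).
  apply: (mulfI detX); rewrite H [\tr (dadj X Z *m N)]mxtrace_mulC H.
  by rewrite mulrC [in X in _ - X]mxtrace_mulC.
rewrite -[LHS]mxtraceZ -mul_scalar_mx -(mul_mx_adj X).
have -> : X *m \adj X *m (P *m dadj X M) = X *m (\adj X *m P *m dadj X M) by rewrite !mulmxA.
rewrite mxtrace_mulC -!mulmxA [\adj X *m (P *m _)]mulmxA.
have E := dadj_mulmx X M.
have {E} -> : dadj X M *m X = (\tr (\adj X *m M))%:M - \adj X *m M by rewrite -E addrK.
by rewrite mulmxBr mul_mx_scalar raddfB /= mxtraceZ [in X in _ - X = _]mxtrace_mulC !mulmxA.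
Qed.

End DomainAdjugate.

(** * The Gulliksen-Negard complex *)

Section Ideals.
Variable A : comNzRingType.
Implicit Types (J : A -> Prop) (f : A).

Definition is_ideal J :=
  [/\ J 0, forall a b, J a -> J b -> J (a + b) & forall c a, J a -> J (c * a)].
Definition nzd_mod J f := forall p, J (f * p) -> J p.
Definition addgen J f := fun p => exists b, J (p - f * b).
Definition mxin J m n (M : 'M[A]_(m, n)) := forall i j, J (M i j).

Lemma zero_is_ideal : is_ideal (fun a => a = 0).
Proof. by split=> // [a b -> ->|c a ->]; rewrite ?addr0 ?mulr0. Qed.

Section Closure.
Variable J : A -> Prop.
Hypothesis idJ : is_ideal J.

Lemma ideal0 : J 0. Proof. by case: idJ. Qed.
Lemma idealD a b : J a -> J b -> J (a + b). Proof. by case: idJ => _ H _; exact: H. Qed.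
Lemma idealMl c a : J a -> J (c * a). Proof. by case: idJ => _ _ H; exact: H. Qed.
Lemma idealMr c a : J a -> J (a * c). Proof. by rewrite mulrC; exact: idealMl. Qed.
Lemma idealN a : J a -> J (- a). Proof. by rewrite -mulN1r; exact: idealMl. Qed.
Lemma idealB a b : J a -> J b -> J (a - b).
Proof. by move=> Ja Jb; apply: idealD Ja (idealN Jb). Qed.
Lemma ideal_sum (I : Type) (s : seq I) (P : pred I) (F : I -> A) :
  (forall i, P i -> J (F i)) -> J (\sum_(i <- s | P i) F i).
Proof. by move=> H; apply: (big_ind J) => //; [exact: ideal0 | exact: idealD]. Qed.

Lemma addgen_is_ideal f : is_ideal (addgen J f).
Proof.
split=> [|a b [x Jx] [y Jy]|c a [x Jx]]; first by exists 0; rewrite mulr0 subr0; exact: ideal0.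
  exists (x + y); have -> : a + b - f * (x + y) = (a - f * x) + (b - f * y) by ring.
  exact: idealD.
exists (c * x); have -> : c * a - f * (c * x) = c * (a - f * x) by ring.
exact: idealMl.
Qed.

Lemma addgenW f a : J a -> addgen J f a.
Proof. by exists 0; rewrite mulr0 subr0. Qed.

Lemma addgen_gen f a : addgen J f (f * a).
Proof. by exists a; rewrite subrr; exact: ideal0. Qed.

Variables m n : nat.
Implicit Types M N : 'M[A]_(m, n).

Lemma mxinD M N : mxin J M -> mxin J N -> mxin J (M + N).
Proof. by move=> JM JN i j; rewrite mxE; apply: idealD. Qed.
Lemma mxinN M : mxin J M -> mxin J (- M).
Proof. by move=> JM i j; rewrite mxE; apply: idealN. Qed.
Lemma mxinB M N : mxin J M -> mxin J N -> mxin J (M - N).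
Proof. by move=> JM JN; apply: mxinD JM (mxinN JN). Qed.
Lemma mxinZl c M : J c -> mxin J (c *: M).
Proof. by move=> Jc i j; rewrite mxE; apply: idealMr. Qed.
Lemma mxinMl p (P : 'M_(p, m)) M : mxin J M -> mxin J (P *m M).
Proof. by move=> JM i j; rewrite mxE; apply: ideal_sum => k _; apply: idealMl. Qed.
Lemma mxinMr p M (P : 'M_(n, p)) : mxin J M -> mxin J (M *m P).
Proof. by move=> JM i j; rewrite mxE; apply: ideal_sum => k _; apply: idealMr. Qed.

Lemma mxin_addgen f M : mxin (addgen J f) M -> exists N, mxin J (M - f *: N).
Proof.
move=> H; have [g Hg] : exists g : 'I_m -> 'I_n -> A, forall i j, J (M i j - f * g i j).
  apply: (fin_all_exists (P := fun i (h : 'I_n -> A) => forall j, J (M i j - f * h j))) => i.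
  by apply: (fin_all_exists (P := fun j b => J (M i j - f * b))) => j; exact: H.
by exists (\matrix_(i, j) g i j) => i j; rewrite !mxE.
Qed.

Lemma mxin_nzd f M : nzd_mod J f -> mxin J (f *: M) -> mxin J M.
Proof. by move=> nf H i j; apply: nf; have := H i j; rewrite mxE. Qed.

End Closure.

Lemma mxinW J f m n (M : 'M_(m, n)) : mxin J M -> mxin (addgen J f) M.
Proof. by move=> H i j; apply: addgenW. Qed.

Lemma mxin_addgen_gen J f m n (M : 'M_(m, n)) : is_ideal J -> mxin (addgen J f) (f *: M).
Proof. by move=> H i j; rewrite mxE; apply: addgen_gen. Qed.

Lemma mxin_tr J n (M : 'M_n) : is_ideal J -> mxin J M -> J (\tr M).
Proof. by move=> idJ JM; apply: ideal_sum => // i _. Qed.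

Lemma mxin_dadj J n (X N : 'M_n) : is_ideal J -> mxin J N -> mxin J (dadj X N).
Proof.
move=> idJ JN i j; rewrite summxE; apply: ideal_sum => // q _; rewrite summxE.
by apply: ideal_sum => // p _; rewrite mxE; apply: idealMr.
Qed.

End Ideals.

(* Exactness modulo J of the Gulliksen-Negard complex
   S -> M_n -> {(P, Q) | tr P = tr Q} / (1, 1) -> M_n -> S,
   c |-> c adj X,  Z |-> (X Z, Z X),  (P, Q) |-> P X - X Q,  Z |-> tr (adj X Z);
   gn_exk is exactness at the k-th module from the right. *)
Section GulliksenNegard.
Variables (A : comNzRingType) (n : nat) (X : 'M[A]_n) (J : A -> Prop).

Definition gn_ex1 := forall Z, J (\tr (\adj X *m Z)) ->
  exists P Q, J (\tr P - \tr Q) /\ mxin J (Z - (P *m X - X *m Q)).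
Definition gn_ex2 := forall P Q, J (\tr P - \tr Q) -> mxin J (P *m X - X *m Q) ->
  exists Z s, mxin J (P - (X *m Z + s%:M)) /\ mxin J (Q - (Z *m X + s%:M)).
Definition gn_ex3 := forall Z s, mxin J (X *m Z - s%:M) -> mxin J (Z *m X - s%:M) ->
  exists c, mxin J (Z - c *: \adj X).
Definition gn_ex4 := forall c, mxin J (c *: \adj X) -> J c.

End GulliksenNegard.

Lemma dadjZ (A : comNzRingType) n (X N : 'M[A]_n) c : dadj X (c *: N) = c *: dadj X N.
Proof.
rewrite /dadj scaler_sumr; apply: eq_bigr => q _; rewrite scaler_sumr.
by apply: eq_bigr => p _; rewrite mxE scalerA.
Qed.

Section Acyclicity.
Variables (A : idomainType) (n : nat) (X : 'M[A]_n).
Hypothesis detX : \det X != 0.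
Variable (J : A -> Prop) (N : 'M[A]_n).
Hypothesis idJ : is_ideal J.
Let f := \tr (\adj X *m N).
Hypothesis nzd_f : nzd_mod J f.

Let idJf : is_ideal (addgen J f) := addgen_is_ideal idJ f.

Lemma gn_ex4_step : gn_ex4 X J.
Proof.
move=> c Jc; apply: nzd_f; rewrite /f mulrC -mxtraceZ scalemxAl.
by apply: mxin_tr => //; apply: mxinMr.
Qed.

(** The homotopy into the leftmost module is [Z |-> \tr (N *m Z)]; exactness modulo [f] makes its
    value [u] divisible by [f]. *)
Lemma gn_ex3_step : gn_ex4 X (addgen J f) -> gn_ex3 X J.
Proof.
move=> ex4 Z s J1 J2; pose u := \tr (N *m Z).
(* The right side vanishes on true cycles; its shape keeps track of the error in [J]. *)
have E : f *: Z - u *: \adj X =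
    dadj X N *m (X *m Z - s%:M) - dadj X (N *m (Z *m X - s%:M)).
  rewrite !mulmxBr dadjB [N *m (Z *m X)]mulmxA dadj_mulr // !mul_mx_scalar dadjZ.
  have D : dadj X N *m X = f%:M - \adj X *m N by rewrite -(dadj_mulmx X N) addrK.
  rewrite mulmxA D mulmxBl mul_scalar_mx mulmxBr mul_mx_scalar -/u [\adj X *m (N *m Z)]mulmxA.
  set a := _ *: \adj X; set b := _ *m Z; set c := _ *: dadj X N.
  by apply/matrixP=> i j; rewrite !mxE; ring.
have JE : mxin J (f *: Z - u *: \adj X).
  by rewrite E; apply: mxinB => //; [apply: mxinMl | apply: mxin_dadj => //; apply: mxinMl].
have [w Jw] : addgen J f u.
  apply: ex4; have -> : u *: \adj X = f *: Z - (f *: Z - u *: \adj X) by rewrite opprB addrC subrK.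
  by apply: mxinB => //; [exact: mxin_addgen_gen | exact: mxinW].
exists w; apply: (mxin_nzd nzd_f).
have -> : f *: (Z - w *: \adj X) = (f *: Z - u *: \adj X) + (u - f * w) *: \adj X.
  by rewrite scalerBr scalerBl scalerA addrA subrK.
by apply: mxinD => //; apply: mxinZl.
Qed.

(** [U] is the homotopy applied to [(P, Q)]. The index [i0] serves to read the scalar of a scalar
    matrix off a diagonal entry. *)
Lemma gn_ex2_step (i0 : 'I_n) : gn_ex3 X (addgen J f) -> gn_ex2 X J.
Proof.
move=> ex3 P Q Jtr JQ; pose t := \tr (\adj X *m (N *m Q)).
pose U := dadj X N *m P - dadj X (N *m Q).
have XD M : X *m dadj X M = (\tr (\adj X *m M))%:M - M *m \adj X.
  by rewrite -(mulmx_dadj X M) addrK.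
have DX M : dadj X M *m X = (\tr (\adj X *m M))%:M - \adj X *m M.
  by rewrite -(dadj_mulmx X M) addrK.
have E1 : X *m U - (f *: P - t%:M) =
    N *m (dadj X (P *m X - X *m Q) - (\tr P - \tr Q) *: \adj X).
  rewrite dadjB dadj_mulr // dadj_mull // [\adj X *m _]mulmxBr mul_mx_scalar mulmxBl mul_scalar_mx.
  have -> : \tr P *: \adj X - \adj X *m P - (\tr Q *: \adj X - Q *m \adj X) - (\tr P - \tr Q) *: \adj X
          = Q *m \adj X - \adj X *m P.
    rewrite scalerBl; set a := _ *: _; set b := _ *: _; set c := _ *m _; set d := _ *m _.
    by apply/matrixP=> i j; rewrite !mxE; ring.
  rewrite /U mulmxBr mulmxA !XD -/f -/t mulmxBl mul_scalar_mx mulmxBr !mulmxA.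
  set a := _ *: _; set b := _ *m _ *m P; set d := _ *m _.
  by apply/matrixP=> i j; rewrite !mxE; ring.
have E2 : U *m X - (f *: Q - t%:M) = dadj X N *m (P *m X - X *m Q).
  rewrite mulmxBr mulmxA [dadj X N *m (X *m Q)]mulmxA.
  rewrite /U mulmxBl !DX -/f -/t mulmxBl mul_scalar_mx !mulmxA.
  set a := _ *: _; set b := _ *m X; set d := _ *m Q.
  by apply/matrixP=> i j; rewrite !mxE; ring.
have J1 : mxin J (X *m U - (f *: P - t%:M)).
  rewrite E1; apply: mxinMl => //; apply: mxinB => //; first exact: mxin_dadj.
  exact: mxinZl.
have J2 : mxin J (U *m X - (f *: Q - t%:M)) by rewrite E2; apply: mxinMl.
have JfM (V M : 'M_n) : mxin J (V - (f *: M - t%:M)) -> mxin (addgen J f) (V - (- t)%:M).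
  move=> JV; have -> : V - (- t)%:M = V - (f *: M - t%:M) + f *: M.
    by rewrite raddfN /= opprK opprB addrA subrK.
  by apply: mxinD => //; [exact: mxinW | exact: mxin_addgen_gen].
have [w /mxin_addgen[Z JZ]] := ex3 U (- t) (JfM _ _ J1) (JfM _ _ J2).
(* The part [w *: \adj X] of [U] contributes [w * \det X] on either side, so both remainders are the
   same scalar. *)
pose s := t + w * \det X.
have K1 : mxin J (f *: (P - X *m Z) - s%:M).
  have -> : f *: (P - X *m Z) - s%:M =
     X *m (U - w *: \adj X - f *: Z) - (X *m U - (f *: P - t%:M)).
    rewrite !mulmxBr -!scalemxAr mul_mx_adj scale_scalar_mx scalerBr /s raddfD /=.
    by apply/matrixP=> i j; rewrite !mxE; ring.
  by apply: mxinB => //; apply: mxinMl.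
have K2 : mxin J (f *: (Q - Z *m X) - s%:M).
  have -> : f *: (Q - Z *m X) - s%:M =
     (U - w *: \adj X - f *: Z) *m X - (U *m X - (f *: Q - t%:M)).
    rewrite !mulmxBl -!scalemxAl mul_adj_mx scale_scalar_mx scalerBr /s raddfD /=.
    by apply/matrixP=> i j; rewrite !mxE; ring.
  by apply: mxinB => //; apply: mxinMr.
(* Modulo [J], [s] is [f] times this entry, so the scalar too is divisible by [f]. *)
pose a := (P - X *m Z) i0 i0.
have Js : mxin J ((s - f * a)%:M : 'M_n).
  have Ja : J (s - f * a).
    have -> : s - f * a = - (f *: (P - X *m Z) - s%:M) i0 i0.
      by rewrite /a !mxE eqxx mulr1n; ring.
    exact: (idealN idJ (K1 i0 i0)).
  by move=> i j; rewrite mxE; case: eqP => _ //=; exact: ideal0.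
exists Z, a; split; apply: (mxin_nzd nzd_f); rewrite opprD addrA.
  have -> : f *: (P - X *m Z - a%:M) = f *: (P - X *m Z) - s%:M + (s - f * a)%:M.
    by rewrite (raddfB (@scalar_mx A n)) /= [LHS]scalerBr scale_scalar_mx addrA subrK.
  exact: mxinD.
have -> : f *: (Q - Z *m X - a%:M) = f *: (Q - Z *m X) - s%:M + (s - f * a)%:M.
  by rewrite (raddfB (@scalar_mx A n)) /= [LHS]scalerBr scale_scalar_mx addrA subrK.
exact: mxinD.
Qed.

(** The trace condition on the homotopy [(P, Q)] is exactly the symmetry [mxtrace_dadjC]. *)
Lemma gn_ex1_step : gn_ex2 X (addgen J f) -> gn_ex1 X J.
Proof.
move=> ex2 Z JZ; pose P := Z *m dadj X N; pose Q := dadj X Z *m N.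
have E : P *m X - X *m Q = f *: Z - \tr (\adj X *m Z) *: N.
  have XD : X *m dadj X Z = (\tr (\adj X *m Z))%:M - Z *m \adj X.
    by rewrite -(mulmx_dadj X Z) addrK.
  have DX : dadj X N *m X = f%:M - \adj X *m N by rewrite -(dadj_mulmx X N) addrK.
  rewrite /P /Q -mulmxA DX mulmxA XD mulmxBl mulmxBr mul_scalar_mx mul_mx_scalar !mulmxA.
  by apply/matrixP=> i j; rewrite !mxE; ring.
have tr0 : addgen J f (\tr P - \tr Q).
  by rewrite /P /Q mxtrace_dadjC // subrr; apply: ideal0.
have JPQ : mxin (addgen J f) (P *m X - X *m Q).
  by rewrite E; apply: mxinB => //; [exact: mxin_addgen_gen | apply: mxinW; apply: mxinZl].
have [Z' [s [/mxin_addgen[P' JP] /mxin_addgen[Q' JQ]]]] := ex2 P Q tr0 JPQ.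
exists P', Q'; split.
  apply: nzd_f.
  have -> : f * (\tr P' - \tr Q') =
     \tr (Q - (Z' *m X + s%:M) - f *: Q') - \tr (P - (X *m Z' + s%:M) - f *: P').
    rewrite !raddfB !raddfD /= !mxtraceZ [\tr (Z' *m X)]mxtrace_mulC mxtrace_dadjC //.
    ring.
  by apply: idealB => //; apply: mxin_tr.
apply: (mxin_nzd nzd_f).
have -> : f *: (Z - (P' *m X - X *m Q')) =
    (P - (X *m Z' + s%:M) - f *: P') *m X - X *m (Q - (Z' *m X + s%:M) - f *: Q')
    + \tr (\adj X *m Z) *: N.
  transitivity (P *m X - X *m Q + \tr (\adj X *m Z) *: N - f *: (P' *m X - X *m Q')).
    by rewrite E subrK scalerBr.
  rewrite !mulmxBl !mulmxBr !mulmxDl !mulmxDr mul_scalar_mx mul_mx_scalar -!scalemxAl -!scalemxAr !mulmxA.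
  by apply/matrixP=> i j; rewrite !mxE; ring.
by apply: mxinD => //; [apply: mxinB => //; [apply: mxinMr | apply: mxinMl] | exact: mxinZl].
Qed.

End Acyclicity.

(** * Setting variables to zero *)

Section Substitution.
Variables (K : fieldType) (N : nat).
Implicit Types (p q : {mpoly K[N]}) (m : 'X_{1..N}) (U : pred 'I_N).

(** Common form of setting variables to zero and of truncating by degree. *)
Definition mfilter (Q : pred 'X_{1..N}) p : {mpoly K[N]} :=
  \sum_(m <- msupp p | Q m) p@_m *: 'X_[m].

Lemma mcoeff_mfilter Q p m : (mfilter Q p)@_m = if Q m then p@_m else 0.
Proof.
rewrite /mfilter raddf_sum /=.
under eq_bigr => m' _ do rewrite mcoeffZ mcoeffX.
case: (boolP (m \in msupp p)) => [mp|mp].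
  rewrite big_mkcond (bigD1_seq m) ?msupp_uniq //= eqxx mulr1 big1 ?addr0 //.
  by move=> m' /negbTE ->; rewrite mulr0 if_same.
rewrite (memN_msupp_eq0 mp) if_same big_seq_cond big1 // => m' /andP[m'p _].
by case: eqP => [E|_]; rewrite ?mulr0 // E (negbTE mp) in m'p *.
Qed.

Lemma mfilter_is_linear Q : linear (mfilter Q).
Proof.
move=> c p q; apply/mpolyP => m.
rewrite !(mcoeffD, mcoeffZ, mcoeff_mfilter); case: ifP => _ //.
by rewrite mulr0 addr0.
Qed.
HB.instance Definition _ Q := GRing.isLinear.Build K {mpoly K[N]} {mpoly K[N]} _
  (mfilter Q) (mfilter_is_linear Q).

Lemma mfilterX Q m : mfilter Q 'X_[m] = if Q m then 'X_[m] else 0.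
Proof.
apply/mpolyP => m'; rewrite mcoeff_mfilter mcoeffX.
case: eqP => [->|/eqP mm']; first by case: ifP; rewrite ?mcoeff0 ?mcoeffX ?eqxx.
by rewrite if_same; case: ifP; rewrite ?mcoeff0 // mcoeffX (negbTE mm').
Qed.

Lemma mfilter_ind (P : {mpoly K[N]} -> Prop) : P 0 ->
  (forall c p q, P p -> P q -> P (c *: p + q)) -> (forall m, P 'X_[m]) -> forall p, P p.
Proof. by move=> P0 PD PX; elim/mpolyind => // c m p _ _ Pp; exact: PD. Qed.

Definition avoids U m := [forall i, U i ==> (m i == 0%N)].

Definition killt U : N.-tuple {mpoly K[N]} := [tuple if U i then 0 else 'X_i | i < N].
Definition kill U := comp_mpoly (killt U).
HB.instance Definition _ U := GRing.RMorphism.on (kill U).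

Lemma killXm U m : kill U 'X_[m] = if avoids U m then 'X_[m] else 0.
Proof.
rewrite /kill comp_mpolyX; case: ifP => [/forallP H|/negbT].
  rewrite [RHS]mpolyXE_id; apply: eq_bigr => i _; rewrite tnth_mktuple.
  by have := H i; case: (U i) => //= /eqP ->; rewrite !expr0.
rewrite negb_forall => /existsP[i]; rewrite negb_imply => /andP[Ui mi].
by rewrite (bigD1 i) //= tnth_mktuple Ui expr0n (negbTE mi) mul0r.
Qed.

(** Substitution makes [kill] a ring morphism, filtering gives its coefficients; this joins the two
    views. *)
Lemma killE U p : kill U p = mfilter (avoids U) p.
Proof.
elim/mfilter_ind: p => [|c p q Hp Hq|m].
- by rewrite /kill comp_mpoly0 linear0.
- by rewrite /kill comp_mpolyD comp_mpolyZ linearP /= -Hp -Hq.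
- by rewrite killXm mfilterX.
Qed.

Lemma mcoeff_kill U p m : (kill U p)@_m = if avoids U m then p@_m else 0.
Proof. by rewrite killE mcoeff_mfilter. Qed.

Lemma killX U i : kill U 'X_i = if U i then 0 else 'X_i.
Proof. by rewrite /kill comp_mpolyXU -tnth_nth tnth_mktuple. Qed.

Lemma kill1_split i p : exists q, p - kill (pred1 i) p = 'X_i * q.
Proof.
elim/mfilter_ind: p => [|c p q [p' Hp] [q' Hq]|m].
- by exists 0; rewrite rmorph0 subr0 mulr0.
- exists (c *: p' + q').
  rewrite mulrDr -scalerAr -Hp -Hq /kill comp_mpolyD comp_mpolyZ scalerBr; ring.
rewrite killXm; case: ifP => [_|/negbT]; first by exists 0; rewrite subrr mulr0.
rewrite negb_forall => /existsP[j]; rewrite negb_imply => /andP[/eqP -> mi].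
exists 'X_[m - U_(i)]; rewrite subr0 -mpolyXD addmC submK //.
by rewrite lep1mP.
Qed.

Lemma mpolyX_neq0 m : 'X_[m] != 0 :> {mpoly K[N]}.
Proof. by rewrite -msupp_eq0 msuppX. Qed.

(** The bound is strict to agree with [msize], which is the degree plus one. *)
Definition trunc d := mfilter (fun m => mdeg m < d)%N.
HB.instance Definition _ d := GRing.Linear.on (trunc d).

Lemma trunc_id d p : (msize p <= d)%N -> trunc d p = p.
Proof.
move=> pd; apply/mpolyP => m; rewrite mcoeff_mfilter; case: ltnP => // dm.
by rewrite memN_msupp_eq0 // msize_mdeg_ge // (leq_trans pd).
Qed.

Lemma msize_trunc d p : (msize (trunc d p) <= d)%N.
Proof.
rewrite msizeE; apply/bigmax_leqP_seq => m; rewrite mcoeff_msupp mcoeff_mfilter.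
by case: ifP => //; rewrite eqxx.
Qed.

(** Multiplication by [e] raises degrees by exactly [k]. When [k] exceeds [d], the truncated
    difference 0 is right, as both sides vanish. *)
Lemma trunc_mulr d k e p : e \is k.-homog -> trunc d (p * e) = trunc (d - k) p * e.
Proof.
move=> /dhomogP he; elim/mfilter_ind: p => [|c p q Hp Hq|m].
- by rewrite mul0r !linear0 mul0r.
- by rewrite mulrDl -scalerAl !linearP /= Hp Hq mulrDl scalerAl.
rewrite {1}(mpolyE e) [in RHS](mpolyE e) !mulr_sumr linear_sum /=.
apply: eq_big_seq => m' /he hm'.
rewrite -!scalerAr linearZ /= -mpolyXD /trunc !mfilterX mdegD hm'.
by rewrite ltn_subRL addnC; case: ifP; rewrite ?mpolyXD ?mul0r.
Qed.

Lemma trunc_mull d k e p : e \is k.-homog -> trunc d (e * p) = e * trunc (d - k) p.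
Proof. by move=> he; rewrite mulrC (trunc_mulr _ _ he) mulrC. Qed.

Lemma homogX i : 'X_i \is (1.-homog : qualifier 0 {mpoly K[N]}).
Proof. by rewrite dhomogX /= mdeg1. Qed.

End Substitution.

(** * Regular elements modulo an ideal *)

Section NonZeroDivisors.
Variable A : comNzRingType.
Implicit Types (J : A -> Prop).

Lemma nzd_modM J a b : nzd_mod J a -> nzd_mod J b -> nzd_mod J (a * b).
Proof. by move=> Ha Hb p; rewrite -mulrA => /Ha /Hb. Qed.

Lemma nzd_mod_prod J (I : Type) (s : seq I) (P : pred I) (F : I -> A) :
  (forall i, P i -> nzd_mod J (F i)) -> nzd_mod J (\prod_(i <- s | P i) F i).
Proof.
move=> H; apply: (big_ind (nzd_mod J)) => //; last exact: nzd_modM.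
by move=> p; rewrite mul1r.
Qed.

(** [A/(J, ab)] is an extension of [A/(J, a)] by a copy of [A/(J, b)], embedded by multiplication by
    [a]; [g] is regular on both. *)
Lemma nzd_addgenM J a b g : is_ideal J -> nzd_mod J a ->
  nzd_mod (addgen J a) g -> nzd_mod (addgen J b) g -> nzd_mod (addgen J (a * b)) g.
Proof.
move=> idJ na Ha Hb p [c Jc].
have [q Jq] : addgen J a p.
  by apply: Ha; exists (b * c); have -> : g * p - a * (b * c) = g * p - a * b * c by ring.
have [r Jr] : addgen J b q.
  apply: Hb; exists c; apply: na.
  have -> : a * (g * q - b * c) = (g * p - a * b * c) - g * (p - a * q) by ring.
  by apply: idealB => //; apply: idealMl.
exists r; have -> : p - a * b * r = (p - a * q) + a * (q - b * r) by ring.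
by apply: idealD => //; apply: idealMl.
Qed.

Lemma nzd_addgen_prod J g (I : Type) (s : seq I) (P : pred I) (F : I -> A) : is_ideal J ->
  (forall i, P i -> nzd_mod J (F i)) -> (forall i, P i -> nzd_mod (addgen J (F i)) g) ->
  nzd_mod (addgen J (\prod_(i <- s | P i) F i)) g.
Proof.
move=> idJ H1 H2.
suff [] : nzd_mod J (\prod_(i <- s | P i) F i) /\ nzd_mod (addgen J (\prod_(i <- s | P i) F i)) g by [].
apply: (big_ind (fun a => nzd_mod J a /\ nzd_mod (addgen J a) g)).
- by split=> p; rewrite ?mul1r // => _; exists p; rewrite mul1r subrr; apply: ideal0.
- by move=> a b [Ha Ha'] [Hb Hb']; split; [exact: nzd_modM | exact: nzd_addgenM].
- by move=> i Pi; split; [exact: H1 | exact: H2].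
Qed.

End NonZeroDivisors.

Section Flat.
Variables (K : fieldType) (N : nat).
Notation S := {mpoly K[N]}.
Implicit Types (J : S -> Prop).

(* J is extended from the polynomial subring without the variable 'X_i. *)
Definition free_of J (i : 'I_N) := (forall p, J p -> J (kill (pred1 i) p)) /\ nzd_mod J 'X_i.

Lemma free_of_zero i : free_of (fun p => p = 0) i.
Proof.
split=> [p ->|p /eqP]; first exact: rmorph0.
by rewrite mulf_eq0 (negbTE (mpolyX_neq0 _ _)) => /eqP.
Qed.

(** If ['X_i * p = f * b] modulo [J], setting ['X_i] to 0 shows that the part of [b] without ['X_i]
    contributes nothing; from the rest ['X_i] cancels. *)
Lemma free_of_addgen J f i : is_ideal J -> kill (pred1 i) f = f -> free_of J i ->
  free_of (addgen J f) i.
Proof.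
move=> idJ kf [Jk nX]; split=> [p [b /Jk]|p [b Jb]].
  by rewrite rmorphB rmorphM /= kf; exists (kill (pred1 i) b).
have [c Ec] := kill1_split i b.
exists c; apply: nX.
have := Jk _ Jb; rewrite rmorphB !rmorphM /= kf killX /= eqxx mul0r sub0r => Jb'.
have -> : 'X_i * (p - f * c) = ('X_i * p - f * b) - (- (f * kill (pred1 i) b)).
  have -> : 'X_i * (p - f * c) = 'X_i * p - f * ('X_i * c) by ring.
  by rewrite -Ec; ring.
exact: idealB.
Qed.

Variables (I : finType) (x : I -> 'I_N).
Hypothesis x_inj : injective x.

Definition omit_prod k : S := \prod_(j | j != k) 'X_(x j).
Definition omit_sum : S := \sum_k omit_prod k.

Lemma kill_omit_prod U k : (forall j, ~~ U (x j)) -> kill U (omit_prod k) = omit_prod k.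
Proof.
move=> H; rewrite rmorph_prod; apply: eq_bigr => j _ /=.
by rewrite killX (negbTE (H j)).
Qed.

Lemma kill_omit_sum U : (forall j, ~~ U (x j)) -> kill U omit_sum = omit_sum.
Proof. by move=> H; rewrite rmorph_sum; apply: eq_bigr => j _; exact: kill_omit_prod. Qed.

Variable J : S -> Prop.
Hypotheses (idJ : is_ideal J) (freeJ : forall k, free_of J (x k)).

Lemma nzd_omit_prod k : nzd_mod J (omit_prod k).
Proof. by apply: nzd_mod_prod => j _; case: (freeJ j). Qed.

(** [omit_prod k0] is a product of variables, so one may work modulo a single ['X_(x k)]. There
    every summand but [omit_prod k] dies, and that one is a product of variables other than
    ['X_(x k)]. *)
Lemma nzd_omit_sum k0 : nzd_mod (addgen J (omit_prod k0)) omit_sum.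
Proof.
apply: nzd_addgen_prod => // k _; first by case: (freeJ k).
have idJk := addgen_is_ideal idJ 'X_(x k).
have nk : nzd_mod (addgen J 'X_(x k)) (omit_prod k).
  apply: nzd_mod_prod => j jk.
  suff [] : free_of (addgen J 'X_(x k)) (x j) by [].
  by apply: free_of_addgen => //; rewrite killX /= (inj_eq x_inj) eq_sym (negbTE jk).
move=> p Jp; apply: nk.
have -> : omit_prod k * p = omit_sum * p - (\sum_(j | j != k) omit_prod j) * p.
  by rewrite /omit_sum (bigD1 k) //= mulrDl addrK.
apply: idealB => //; apply: idealMr => //; apply: ideal_sum => // j jk.
by rewrite /omit_prod (bigD1 k) 1?eq_sym //=; apply: addgen_gen.
Qed.

End Flat.

(** * The cyclic bidiagonal matrix *)

Section CyclicDistance.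
Variable n : nat.
Implicit Types i j k : 'I_n.

(** The number of cyclic steps from [j] to [k], as the residue of [k - j] modulo [n]. *)
Definition cdist j k : nat := ((k + (n - j)) %% n)%N.

Lemma cdistE j k : cdist j k = (if (j <= k)%N then k - j else k + n - j)%N.
Proof.
rewrite /cdist; case: leqP => jk.
  have -> : (k + (n - j) = (k - j) + n)%N by have := ltn_ord j; lia.
  by rewrite modnDr modn_small //; have := ltn_ord k; lia.
rewrite modn_small; have := ltn_ord j; lia.
Qed.

Lemma val_ordS k : val (ordS k) = (if k.+1 == n then 0 else k.+1)%N.
Proof.
rewrite /=; case: eqP => [->|H]; first by rewrite modnn.
by rewrite modn_small //; have := ltn_ord k; lia.
Qed.

Lemma cdist_ordS j k : cdist (ordS j) k = (if k == j then n.-1 else (cdist j k).-1)%N.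
Proof.
rewrite !cdistE val_ordS -val_eqE /=.
have := ltn_ord j; have := ltn_ord k.
by case: eqP => ?; case: eqP => ?; repeat case: leqP => ?; lia.
Qed.

Lemma cdist_eq0 j k : (cdist j k == 0%N) = (k == j).
Proof.
rewrite cdistE; have := ltn_ord j; have := ltn_ord k.
by case: (leqP j k) => ? ? ?; apply/eqP/eqP => [?|/(congr1 val) /= ?]; try apply: val_inj => /=; lia.
Qed.

Lemma cdistnn j : cdist j j = 0%N.
Proof. by apply/eqP; rewrite cdist_eq0. Qed.

Lemma cdist_lt j k : (cdist j k < n)%N.
Proof. by rewrite ltn_pmod //; have := ltn_ord j; lia. Qed.

Lemma cdist_inj j : injective (cdist j).
Proof.
move=> k l; rewrite !cdistE => H; apply: val_inj => /=.
have := ltn_ord j; have := ltn_ord k; have := ltn_ord l.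
by move: H; repeat case: leqP => ?; lia.
Qed.

Lemma ordS_neq k : (1 < n)%N -> ordS k != k.
Proof.
move=> n1; rewrite -val_eqE val_ordS; have := ltn_ord k.
by case: (k.+1 =P n) => ? ?; apply/eqP => /= ?; lia.
Qed.

End CyclicDistance.

Section CyclicMatrix.
Variables (A : comNzRingType) (n : nat) (o u : 'I_n -> A).

(** With the minus sign on the superdiagonal, the entries of the adjugate are products without
    sign. *)
Definition cyc_mx : 'M[A]_n := \matrix_(i, j) (o i *+ (j == i) - u i *+ (j == ordS i)).

(* Column j and row i of cyc_mx removed, the rows from j up to (cyclically) i - 1
   must use their superdiagonal entry and the others their diagonal one. *)
Definition cyc_choice (j i k : 'I_n) : bool := (cdist j k < cdist j i)%N.
Definition cyc_adj : 'M[A]_n :=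
  \matrix_(j, i) \prod_(k | k != i) (if cyc_choice j i k then u k else o k).

(** Moving the start from [r] to [ordS r] changes only the choice in row [r], so off the diagonal
    the two terms cancel. On the diagonal, the start [i] takes every [o] and the start [ordS i]
    every [u]. *)
Lemma mul_cyc_adj : (1 < n)%N -> cyc_mx *m cyc_adj = (\prod_k o k - \prod_k u k)%:M.
Proof.
move=> n1; apply/matrixP=> r i; rewrite mxE.
rewrite (eq_bigr (fun k => o r * cyc_adj k i *+ (k == r) - u r * cyc_adj k i *+ (k == ordS r))); last first.
  by move=> k _; rewrite [in LHS]mxE mulrBl !mulrnAl.
rewrite sumrB (bigD1 r) //= eqxx mulr1n big1 ?addr0; last by move=> k /negbTE ->.
rewrite (bigD1 (ordS r)) //= eqxx mulr1n big1 ?addr0; last by move=> k /negbTE ->.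
rewrite !mxE; case: (eqVneq r i) => [<-|ri].
  rewrite mulr1n !(bigD1 (P := xpredT) r) //=; congr (_ * _ - _ * _); apply: eq_bigr => k kr.
    by rewrite /cyc_choice cdistnn //.
  rewrite /cyc_choice !cdist_ordS eqxx (negbTE kr).
  have := cdist_lt r k; rewrite -cdist_eq0 in kr => ?.
  by rewrite ifT //; lia.
rewrite !(bigD1 (P := fun k => k != i) r) //= mulr0n.
have -> : cyc_choice r i r = true.
  rewrite /cyc_choice cdistnn //.
  by rewrite lt0n cdist_eq0 eq_sym.
have -> : cyc_choice (ordS r) i r = false.
  rewrite /cyc_choice !cdist_ordS eqxx eq_sym (negbTE ri).
  by have := cdist_lt r i => ?; apply/negbTE; lia.
rewrite [o r * _]mulrCA.
suff -> : \prod_(k | (k != i) && (k != r)) (if cyc_choice r i k then u k else o k) =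
  \prod_(k | (k != i) && (k != r)) (if cyc_choice (ordS r) i k then u k else o k).
  by rewrite subrr.
apply: eq_bigr => k /andP[ki kr]; congr (if _ then _ else _).
rewrite /cyc_choice !cdist_ordS (negbTE kr) [i == r]eq_sym (negbTE ri).
have : cdist r k != 0%N by rewrite cdist_eq0.
have : cdist r i != 0%N by rewrite cdist_eq0 eq_sym.
lia.
Qed.

End CyclicMatrix.

Section CyclicAdjugate.
Variables (A : idomainType) (n : nat) (o u : 'I_n -> A).
Hypotheses (n1 : (1 < n)%N) (o_neq0 : forall k, o k != 0).

(** Without row and column 0 the matrix is triangular, and its determinant is also an entry of
    [cyc_adj]. This one nonzero entry fixes the factor between the adjugate and [cyc_adj]. *)
Lemma det_cyc_mx : \det (cyc_mx o u) = \prod_k o k - \prod_k u k.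
Proof.
case: n o u n1 o_neq0 => // n' o' u' n1' o0.
have E : cofactor (cyc_mx o' u') ord0 ord0 = \prod_(k | k != ord0) o' k.
  rewrite /cofactor addn0 expr0 mul1r -det_tr det_trig.
    rewrite [RHS]big_mkcond big_ord_recl /= mul1r; apply: eq_bigr => i _.
    rewrite !mxE eqxx mulr1n eq_sym (negbTE (ordS_neq _ _)) //.
    by rewrite mulr0n subr0.
  apply/is_trig_mxP => i j ij; rewrite !mxE.
  rewrite -val_eqE /= /bump /= !add1n eqSS (ltn_eqF ij).
  have -> : (lift ord0 i == ordS (lift ord0 j)) = false.
    apply/eqP => /(congr1 val); rewrite val_ordS /= /bump /= !add1n.
    by case: eqP => // _; case: i j ij => i ? [j ?] /=; lia.
  by rewrite !mulr0n subrr.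
have := congr1 (mulmx (\adj (cyc_mx o' u'))) (mul_cyc_adj o' u' n1').
rewrite mulmxA mul_adj_mx mul_scalar_mx mul_mx_scalar => /matrixP/(_ ord0 ord0).
rewrite mxE [RHS]mxE [\adj _ _ _]mxE E.
have -> : cyc_adj o' u' ord0 ord0 = \prod_(k | k != ord0) o' k.
  by rewrite mxE; apply: eq_bigr => k _; rewrite /cyc_choice cdistnn //.
by apply: mulIf; apply/prodf_neq0 => k _; exact: o0.
Qed.

Lemma adj_cyc_mx : \prod_k o k != \prod_k u k -> \adj (cyc_mx o u) = cyc_adj o u.
Proof.
rewrite -subr_eq0 -det_cyc_mx => d0; apply: (mulmx_detI d0).
by rewrite mul_mx_adj mul_cyc_adj // det_cyc_mx.
Qed.

End CyclicAdjugate.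

(** * Deformation of the complex *)

Definition zero_ideal (A : comNzRingType) : A -> Prop := fun a => a = 0.

Lemma mxin_zeroP (A : comNzRingType) m n (M : 'M[A]_(m, n)) : mxin (@zero_ideal A) M <-> M = 0.
Proof.
split=> [H|-> i j]; last by rewrite mxE.
by apply/matrixP => i j; rewrite (H i j) mxE.
Qed.

Lemma mxin_zeroB (A : comNzRingType) m n (M N : 'M[A]_(m, n)) :
  mxin (@zero_ideal A) (M - N) <-> M = N.
Proof. by rewrite mxin_zeroP; split=> [/subr0_eq|->]; rewrite ?subrr. Qed.

Lemma mxtrace_map (A B : comNzRingType) (f : {rmorphism A -> B}) n (M : 'M[A]_n) :
  \tr (map_mx f M) = f (\tr M).
Proof. by rewrite /mxtrace rmorph_sum; apply: eq_bigr => i _; rewrite mxE. Qed.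

Lemma mxtrace_adj_cycle (A : comNzRingType) n (X P Q : 'M[A]_n) : \tr P = \tr Q ->
  \tr (\adj X *m (P *m X - X *m Q)) = 0.
Proof.
move=> PQ; rewrite mulmxBr raddfB /= !mulmxA mul_adj_mx [\tr (_ *m X)]mxtrace_mulC mulmxA mul_mx_adj.
by rewrite !mul_scalar_mx !mxtraceZ PQ subrr.
Qed.

Section Deformation.
Variables (K : fieldType) (N : nat).
Notation S := {mpoly K[N]}.

Lemma mpolyXI m : injective ( *%R ('X_[m] : S)).
Proof. by apply: mulfI; apply: mpolyX_neq0. Qed.

Lemma scalemxXI m a b : injective ( *:%R ('X_[m] : S) : 'M[S]_(a, b) -> 'M[S]_(a, b)).
Proof. by apply: scalemx_inj; apply: mpolyX_neq0. Qed.

Lemma kill_mx_eq0 (i : 'I_N) a b (M : 'M[S]_(a, b)) : map_mx (kill (pred1 i)) M = 0 ->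
  exists M', M = 'X_i *: M'.
Proof.
move=> H; have [g Hg] : exists g : 'I_a -> 'I_b -> S, forall k l, M k l = 'X_i * g k l.
  apply: (fin_all_exists (P := fun k (h : 'I_b -> S) => forall l, M k l = 'X_i * h l)) => k.
  apply: (fin_all_exists (P := fun l b => M k l = 'X_i * b)) => l.
  have [q Hq] := kill1_split i (M k l); exists q; rewrite -Hq.
  by move/matrixP/(_ k l): H; rewrite !mxE => ->; rewrite subr0.
by exists (\matrix_(k, l) g k l); apply/matrixP=> k l; rewrite !mxE.
Qed.

Lemma kill_kill U V p : kill U (kill V p) = kill (predU U V) p :> S.
Proof.
apply/mpolyP => m; rewrite !mcoeff_kill.
have -> : avoids (predU U V) m = avoids U m && avoids V m.
  apply/forallP/andP => [H|[/forallP H1 /forallP H2] i].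
    by split; apply/forallP => i; apply/implyP => Ui; have := H i; rewrite /= Ui ?orbT.
  by rewrite /=; have := H1 i; have := H2 i; case: (U i); case: (V i).
by case: ifP.
Qed.

Lemma eq_kill U V : U =1 V -> kill U =1 kill V :> (S -> S).
Proof.
move=> UV p; apply/mpolyP => m; rewrite !mcoeff_kill; congr (if _ then _ else _).
by apply: eq_forallb => i; rewrite UV.
Qed.

Lemma kill_idem U p : kill U (kill U p) = kill U p :> S.
Proof. by rewrite kill_kill; apply: eq_kill => i /=; rewrite orbb. Qed.

Definition msize_le d a b (M : 'M[S]_(a, b)) := forall i j, (msize (M i j) <= d)%N.

Lemma msize_le0 a b (M : 'M[S]_(a, b)) : msize_le 0 M -> M = 0.
Proof.
move=> H; apply/matrixP => i j; rewrite mxE; apply/eqP; rewrite -(msize_poly_eq0).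
by rewrite -leqn0 H.
Qed.

Lemma msize_le_exists a b (M : 'M[S]_(a, b)) : exists d, msize_le d M.
Proof.
exists (\max_i \max_j msize (M i j))%N => i j.
by apply: leq_trans (leq_bigmax i); apply: (leq_bigmax (F := fun j => msize (M i j))).
Qed.

Lemma msize_leW d d' a b (M : 'M[S]_(a, b)) : (d <= d')%N -> msize_le d M -> msize_le d' M.
Proof. by move=> H Hd i j; apply: leq_trans H. Qed.

Lemma trunc_mx_id d a b (M : 'M[S]_(a, b)) : msize_le d M -> map_mx (trunc d) M = M.
Proof. by move=> H; apply/matrixP => i j; rewrite mxE trunc_id. Qed.

Lemma msize_le_trunc d a b (M : 'M[S]_(a, b)) : msize_le d (map_mx (trunc d) M).
Proof. by move=> i j; rewrite mxE msize_trunc. Qed.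

Lemma trunc_mulmxr d k a b c (P : 'M[S]_(a, b)) (M : 'M[S]_(b, c)) :
  (forall i j, M i j \is k.-homog) ->
  map_mx (trunc d) (P *m M) = map_mx (trunc (d - k)) P *m M.
Proof.
move=> H; apply/matrixP=> i j; rewrite !mxE linear_sum; apply: eq_bigr => l _.
by rewrite mxE; exact: trunc_mulr.
Qed.

Lemma trunc_mulmxl d k a b c (P : 'M[S]_(b, c)) (M : 'M[S]_(a, b)) :
  (forall i j, M i j \is k.-homog) ->
  map_mx (trunc d) (M *m P) = M *m map_mx (trunc (d - k)) P.
Proof.
move=> H; apply/matrixP=> i j; rewrite !mxE linear_sum; apply: eq_bigr => l _.
by rewrite mxE; exact: trunc_mull.
Qed.

Lemma trunc_scaleX d i a b (P : 'M[S]_(a, b)) :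
  map_mx (trunc d.+1) ('X_i *: P) = 'X_i *: map_mx (trunc d) P.
Proof.
apply/matrixP=> k l; rewrite !mxE (trunc_mull _ _ (homogX K i)).
by rewrite subn1.
Qed.

Variables (n : nat).
Implicit Types M : 'M[S]_n.

Lemma homog_det k a (M : 'M[S]_a) : (forall i j, M i j \is k.-homog) -> \det M \is (a * k).-homog.
Proof.
move=> H; rewrite /determinant; apply: rpred_sum => s _.
rewrite rpredMsign.
have : \prod_i M i (s i) \is (\sum_(i < a) k).-homog.
  apply: (big_rec2 (fun (p : S) d => p \is d.-homog)); first exact: dhomog1.
  by move=> i d p _ Hp; apply: dhomogM.
by rewrite sum_nat_const card_ord.
Qed.

Lemma homog_adj M : (forall i j, M i j \is 1.-homog) -> forall i j, \adj M i j \is (n.-1).-homog.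
Proof.
move=> H i j; rewrite mxE /cofactor rpredMsign.
have := @homog_det 1 _ (row' j (col' i M)); rewrite muln1; apply.
by move=> a b; rewrite !mxE.
Qed.

Variable M : 'M[S]_n.
Hypothesis homogM : forall i j, M i j \is 1.-homog.
Variable i : 'I_N.
Let sigma := kill (pred1 i) : S -> S.
Let M' := map_mx sigma M.

Let mapM (a b c : nat) (P : 'M[S]_(a, b)) (Q : 'M[S]_(b, c)) :
  map_mx sigma (P *m Q) = map_mx sigma P *m map_mx sigma Q.
Proof. exact: map_mxM. Qed.
Let mapB (a b : nat) (P Q : 'M[S]_(a, b)) :
  map_mx sigma (P - Q) = map_mx sigma P - map_mx sigma Q.
Proof. exact: map_mxB. Qed.
Let mapD (a b : nat) (P Q : 'M[S]_(a, b)) :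
  map_mx sigma (P + Q) = map_mx sigma P + map_mx sigma Q.
Proof. exact: map_mxD. Qed.
Let mapS a (s : S) : map_mx sigma (s%:M : 'M_a) = (sigma s)%:M.
Proof. exact: map_scalar_mx. Qed.
Let mapZ a b s (P : 'M_(a, b)) : map_mx sigma (s *: P) = sigma s *: map_mx sigma P.
Proof. exact: map_mxZ. Qed.
Let mapadj : map_mx sigma (\adj M) = \adj M'.
Proof. exact: map_mx_adj. Qed.
Let sig2 a b (P : 'M_(a, b)) : map_mx sigma (map_mx sigma P) = map_mx sigma P.
Proof. by apply/matrixP => k l; rewrite !mxE; exact: kill_idem. Qed.
Let sigtr (P : 'M_n) : \tr (map_mx sigma P) = sigma (\tr P).
Proof. exact: mxtrace_map. Qed.
Let zero := @zero_ideal S.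

(** Polynomials without ['X_i] form a subring, so the matrices found for [M'] lift to themselves
    once [sigma] is applied. *)
Lemma gn_ex1_lift_syzygy : gn_ex1 M' zero -> forall Z, sigma (\tr (\adj M *m Z)) = 0 ->
  exists P Q Z', \tr P = \tr Q /\ Z - (P *m M - M *m Q) = 'X_i *: Z'.
Proof.
move=> ex1 Z; rewrite -sigtr mapM mapadj => /ex1[P [Q [/subr0_eq PQ /mxin_zeroB E]]].
have [Z' HZ'] : exists Z', Z - (map_mx sigma P *m M - M *m map_mx sigma Q) = 'X_i *: Z'.
  apply: kill_mx_eq0; rewrite -/sigma !(mapB, mapM) !sig2 -/M' -[map_mx sigma Z]sig2 E.
  by rewrite !(mapB, mapM) -[map_mx sigma M']/(map_mx sigma (map_mx sigma M)) sig2 subrr.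
by exists (map_mx sigma P), (map_mx sigma Q), Z'; rewrite !sigtr PQ.
Qed.

(** Boundaries have trace 0 against [\adj M], so only the multiple of ['X_i] counts. This is
    regularity of ['X_i] modulo the minors of [M]. *)
Lemma gn_ex1_regular : gn_ex1 M' zero -> forall g Z, 'X_i * g = \tr (\adj M *m Z) ->
  exists Z', g = \tr (\adj M *m Z').
Proof.
move=> ex1 g Z E.
have [|P [Q [Z' [PQ EZ]]]] := gn_ex1_lift_syzygy ex1 (Z := Z).
  by rewrite -E /sigma rmorphM /= killX /= eqxx mul0r.
exists Z'; apply: (@mpolyXI U_(i)%MM).
rewrite E -mxtraceZ scalemxAr -EZ mulmxBr raddfB /= mxtrace_adj_cycle //.
by rewrite subr0.
Qed.

Lemma gn_ex1_deform : gn_ex1 M' zero -> gn_ex1 M zero.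
Proof.
move=> ex1; suff H d Z : msize_le d Z -> \tr (\adj M *m Z) = 0 ->
    exists P Q, \tr P = \tr Q /\ Z = P *m M - M *m Q.
  move=> Z trZ; have [d /H/(_ trZ)[P [Q [PQ E]]]] := msize_le_exists Z.
  by exists P, Q; split; [rewrite PQ; exact: subrr | apply/mxin_zeroB].
elim: d Z => [Z /msize_le0 -> _|d IH Z szZ trZ].
  by exists 0, 0; rewrite mul0mx mulmx0 subr0.
have [|P [Q [Z' [PQ EZ]]]] := gn_ex1_lift_syzygy ex1 (Z := Z).
  by rewrite trZ /sigma rmorph0.
(* Nothing bounds the degrees of the lifts. Since [M] is linear, cutting [P], [Q] and [Z'] at [d]
   cuts the equation at [d.+1], where [Z] is unchanged. *)
pose tP := map_mx (trunc d) P; pose tQ := map_mx (trunc d) Q; pose Z2 := map_mx (trunc d) Z'.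
have tPQ : \tr tP = \tr tQ.
  have H (T : 'M_n) : \tr (map_mx (trunc d) T) = trunc d (\tr T).
    by rewrite /mxtrace linear_sum; apply: eq_bigr => k _; rewrite mxE.
  by rewrite !H PQ.
have {}EZ : Z - (tP *m M - M *m tQ) = 'X_i *: Z2.
  have := congr1 (map_mx (trunc d.+1)) EZ; rewrite trunc_scaleX => <-.
  rewrite !raddfB /= (trunc_mx_id szZ) (trunc_mulmxr _ _ homogM) (trunc_mulmxl _ _ homogM).
  by rewrite subn1.
have [||P2 [Q2 [PQ2 E2]]] := IH Z2; first exact: msize_le_trunc.
  apply: (@mpolyXI U_(i)%MM); rewrite mulr0 -mxtraceZ scalemxAr -EZ mulmxBr raddfB /=.
  by rewrite mxtrace_adj_cycle // trZ subr0.
exists (tP + 'X_i *: P2), (tQ + 'X_i *: Q2); split; first by rewrite !mxtraceD !mxtraceZ tPQ PQ2.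
move/(canRL (subrK _)): EZ => ->; rewrite E2 mulmxDl mulmxDr -scalemxAl -scalemxAr scalerBr.
set a := _ *m _; set b := _ *m tQ; set c := _ *: _; set e := _ *: _.
by apply/matrixP=> k l; rewrite !mxE; ring.
Qed.

Lemma gn_ex2_deform : gn_ex2 M' zero -> gn_ex2 M zero.
Proof.
move=> ex2; suff H d P Q : msize_le d P -> msize_le d Q -> \tr P = \tr Q -> P *m M = M *m Q ->
    exists Z s, P = M *m Z + s%:M /\ Q = Z *m M + s%:M.
  move=> P Q /subr0_eq PQ /mxin_zeroB E; have [d1 sP] := msize_le_exists P.
  have [d2 sQ] := msize_le_exists Q.
  have sP' := msize_leW (leq_maxl d1 d2) sP; have sQ' := msize_leW (leq_maxr d1 d2) sQ.
  have [Z [s [E1 E2]]] := H _ _ _ sP' sQ' PQ E.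
  by exists Z, s; split; apply/mxin_zeroB.
elim: d P Q => [P Q /msize_le0 -> /msize_le0 -> _ _|d IH P Q szP szQ PQ E].
  by exists 0, 0; rewrite mul0mx mulmx0 raddf0 addr0.
have [||Z [s [/mxin_zeroB E1 /mxin_zeroB E2]]] := ex2 (map_mx sigma P) (map_mx sigma Q).
- by rewrite !sigtr PQ; exact: subrr.
- by apply/mxin_zeroB; rewrite -!mapM E.
have sM' : map_mx sigma M' = M' by exact: sig2.
have [P' EP] : exists P', P - (M *m map_mx sigma Z + (sigma s)%:M) = 'X_i *: P'.
  apply: kill_mx_eq0; rewrite -/sigma mapB mapD mapM sig2 -mapS sig2 -/M' -[map_mx sigma P]sig2 E1.
  by rewrite mapD mapM sM' subrr.
have [Q' EQ] : exists Q', Q - (map_mx sigma Z *m M + (sigma s)%:M) = 'X_i *: Q'.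
  apply: kill_mx_eq0; rewrite -/sigma mapB mapD mapM sig2 -mapS sig2 -/M' -[map_mx sigma Q]sig2 E2.
  by rewrite mapD mapM sM' subrr.
(* [s] stands alone in the equation and is cut at [d.+1], while [Z] is multiplied by the linear
   [M]. *)
pose Z1 := map_mx (trunc d) (map_mx sigma Z); pose s1 := trunc d.+1 (sigma s).
pose P2 := map_mx (trunc d) P'; pose Q2 := map_mx (trunc d) Q'.
have tS k (a : S) : map_mx (trunc k) (a%:M : 'M_n) = (trunc k a)%:M.
  by apply/matrixP => x y; rewrite !mxE; case: eqP; rewrite ?linear0.
have {}EP : P - (M *m Z1 + s1%:M) = 'X_i *: P2.
  have := congr1 (map_mx (trunc d.+1)) EP; rewrite trunc_scaleX => <-.
  by rewrite map_mxB map_mxD (trunc_mx_id szP) (trunc_mulmxl _ _ homogM) tS subn1.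
have {}EQ : Q - (Z1 *m M + s1%:M) = 'X_i *: Q2.
  have := congr1 (map_mx (trunc d.+1)) EQ; rewrite trunc_scaleX => <-.
  by rewrite map_mxB map_mxD (trunc_mx_id szQ) (trunc_mulmxr _ _ homogM) tS subn1.
have [||||Z2 [s2 [E3 E4]]] := IH P2 Q2; try exact: msize_le_trunc.
- apply: (@mpolyXI U_(i)%MM); rewrite -!mxtraceZ -EP -EQ !raddfB !raddfD /= PQ.
  by rewrite [\tr (M *m _)]mxtrace_mulC.
- apply: (@scalemxXI U_(i)%MM); rewrite scalemxAl scalemxAr -EP -EQ mulmxBl mulmxBr E.
  by rewrite mulmxDl mulmxDr mul_scalar_mx mul_mx_scalar mulmxA.
exists (Z1 + 'X_i *: Z2), (s1 + 'X_i * s2).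
rewrite mulmxDr mulmxDl -scalemxAl -scalemxAr raddfD /= -scale_scalar_mx; split.
  by move/(canRL (subrK _)): EP => ->; rewrite E3 scalerDr addrC addrACA.
by move/(canRL (subrK _)): EQ => ->; rewrite E4 scalerDr addrC addrACA.
Qed.

Lemma gn_ex3_deform (i0 : 'I_n) : gn_ex3 M' zero -> gn_ex3 M zero.
Proof.
move=> ex3; suff H d Z s : msize_le d Z -> M *m Z = s%:M -> Z *m M = s%:M ->
    exists c, Z = c *: \adj M.
  move=> Z s /mxin_zeroB E1 /mxin_zeroB E2; have [d sZ] := msize_le_exists Z.
  by have [c E] := H _ _ _ sZ E1 E2; exists c; apply/mxin_zeroB.
elim: d Z s => [Z s /msize_le0 -> _ _|d IH Z s szZ E1 E2].
  by exists 0; rewrite scale0r.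
have [||c /mxin_zeroB E] := ex3 (map_mx sigma Z) (sigma s).
- by apply/mxin_zeroB; rewrite -mapM E1 mapS.
- by apply/mxin_zeroB; rewrite -mapM E2 mapS.
have [Z' EZ] : exists Z', Z - sigma c *: \adj M = 'X_i *: Z'.
  apply: kill_mx_eq0; rewrite -/sigma mapB mapZ mapadj -[map_mx sigma Z]sig2 E mapZ -mapadj sig2.
  by rewrite [sigma (sigma c)]kill_idem subrr.
(* Cofactors have degree [n.-1], hence the lower cut for [c]. *)
pose c1 := trunc (d.+1 - n.-1) (sigma c); pose Z2 := map_mx (trunc d) Z'.
have {}EZ : Z - c1 *: \adj M = 'X_i *: Z2.
  have := congr1 (map_mx (trunc d.+1)) EZ; rewrite trunc_scaleX => <-.
  rewrite raddfB /= (trunc_mx_id szZ); congr (_ - _); apply/matrixP => k l.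
  by rewrite !mxE -[cofactor _ _ _](mxE adjugate_key (fun i j => cofactor M j i)) (trunc_mulr _ _ (homog_adj homogM k l)).
(* The induction hypothesis asks for scalar products; a scalar multiple of ['X_i] is divided, and
   the quotient read off at [i0]. *)
have sc (T : 'M[S]_n) a : 'X_i *: T = a%:M -> T = (T i0 i0)%:M.
  move=> HT; apply: (@scalemxXI U_(i)%MM); rewrite HT scale_scalar_mx; congr (_%:M).
  by move/matrixP/(_ i0 i0): HT; rewrite !mxE eqxx.
have F1 : 'X_i *: (M *m Z2) = (s - c1 * \det M)%:M.
  by rewrite scalemxAr -EZ mulmxBr E1 -scalemxAr mul_mx_adj scale_scalar_mx raddfB.
have F2 : 'X_i *: (Z2 *m M) = (s - c1 * \det M)%:M.
  by rewrite scalemxAl -EZ mulmxBl E2 -scalemxAl mul_adj_mx scale_scalar_mx raddfB.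
have G : Z2 *m M = M *m Z2 by apply: (@scalemxXI U_(i)%MM); rewrite F1 F2.
have [|||c2 Ec] := IH Z2 ((M *m Z2) i0 i0).
- exact: msize_le_trunc.
- exact: sc F1.
- by rewrite G; exact: sc F1.
exists (c1 + 'X_i * c2); move/(canRL (subrK _)): EZ => ->.
by rewrite Ec scalerA addrC scalerDl.
Qed.

End Deformation.

(** * From the cyclic matrix to the generic one *)

Section GenericMatrix.
Variables (K : fieldType) (n : nat).
Hypothesis n2 : (2 < n)%N.
Notation S := {mpoly K[n * n]}.
Notation var := ('I_n * 'I_n)%type.

Lemma vidx_inj : injective (vidx n).
Proof.
move=> [i j] [k l]; rewrite /vidx /=.
by move/(bij_inj (onT_bij (curry_mxvec_bij n n)) (x1 := (i, j)) (x2 := (k, l))).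
Qed.

Lemma vidx_surj (i : 'I_(n * n)) : exists v, vidx n v = i.
Proof. by case/mxvec_indexP: i => a b; exists (a, b). Qed.

Lemma xvar_neq0 v : xvar K n v != 0.
Proof. exact: mpolyX_neq0. Qed.

Definition diag_var (k : 'I_n) : var := (k, k).
(** [ordS] wraps around, so the last of these is the corner variable. *)
Definition super_var (k : 'I_n) : var := (k, ordS k).

Lemma inVE (v : var) : inV n v = (v == diag_var v.1) || (v == super_var v.1).
Proof.
case: v => i j; rewrite /inV /diag_var /super_var /= !xpair_eqE !eqxx /=.
rewrite -!val_eqE val_ordS /=; have := ltn_ord i; have := ltn_ord j.
move=> *; case: (i.+1 =P n) => *; lia.
Qed.

Lemma diag_var_inj : injective diag_var. Proof. by move=> i j []. Qed.
Lemma super_var_inj : injective super_var. Proof. by move=> i j []. Qed.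

Lemma diag_neq_super k l : diag_var k != super_var l.
Proof.
apply/eqP => -[-> E]; have := @ordS_neq n l (ltnW n2); by rewrite -E eqxx.
Qed.

Lemma inV_diag k : inV n (diag_var k). Proof. by rewrite inVE eqxx. Qed.
Lemma inV_super k : inV n (super_var k). Proof. by rewrite inVE eqxx orbT. Qed.

Lemma Ymx_cyc : Ymx K n = cyc_mx (fun k => xvar K n (diag_var k)) (fun k => - xvar K n (super_var k)).
Proof.
apply/matrixP => i j; rewrite !mxE inVE /= /diag_var /super_var !xpair_eqE eqxx /=.
have ne := @ordS_neq n i (ltnW n2).
case: (eqVneq j i) => [->|ji] /=.
  by rewrite eq_sym (negbTE ne) mulr0n subr0.
by case: eqP => [->|]; rewrite mulr0n mulNrn ?mulr1n ?mulr0n ?oppr0 ?opprK add0r.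
Qed.

Lemma omit_signed (I : finType) (x : I -> 'I_(n * n)) k :
  \prod_(j | j != k) - ('X_(x j) : S) = (-1) ^+ #|I|.-1 * omit_prod K x k.
Proof. by rewrite prodrN cardC1. Qed.

Lemma diag_prod_neq : \prod_k xvar K n (diag_var k) != \prod_k - xvar K n (super_var k).
Proof.
pose k0 : 'I_n := Ordinal (ltnW (ltnW n2)).
apply/eqP => /(congr1 (kill (pred1 (vidx n (diag_var k0))))); rewrite !rmorph_prod.
rewrite (bigD1 k0) //= killX /= eqxx mul0r => /esym/eqP; apply/negP.
apply/prodf_neq0 => k _; rewrite rmorphN /= killX /= (inj_eq vidx_inj) [_ == diag_var _]eq_sym.
by rewrite (negbTE (diag_neq_super _ _)) oppr_eq0 xvar_neq0.
Qed.

Lemma adj_Ymx : \adj (Ymx K n) =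
  cyc_adj (fun k => xvar K n (diag_var k)) (fun k => - xvar K n (super_var k)).
Proof.
rewrite Ymx_cyc adj_cyc_mx ?(ltnW n2) //; last exact: diag_prod_neq.
by move=> k; apply: xvar_neq0.
Qed.

Lemma det_Ymx_neq0 : \det (Ymx K n) != 0.
Proof.
rewrite Ymx_cyc det_cyc_mx ?(ltnW n2) //; last by move=> k; apply: xvar_neq0.
by rewrite subr_eq0 diag_prod_neq.
Qed.

Let zero := @zero_ideal S.

(** [gn_ex1] over 0 rests on [gn_ex2] modulo one element, [gn_ex3] modulo two and [gn_ex4] modulo
    three; the last needs a fourth regular element. *)
Lemma gn_Ymx : [/\ gn_ex1 (Ymx K n) zero, gn_ex2 (Ymx K n) zero & gn_ex3 (Ymx K n) zero].
Proof.
pose k0 : 'I_n := Ordinal (ltnW (ltnW n2)).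
have d0 := det_Ymx_neq0.
pose x k := vidx n (diag_var k); pose y k := vidx n (super_var k).
have x_inj : injective x by move=> i j /vidx_inj /diag_var_inj.
have y_inj : injective y by move=> i j /vidx_inj /super_var_inj.
have xy i j : x i != y j by rewrite (inj_eq vidx_inj) diag_neq_super.
pose sg : S := (-1) ^+ n.-1.
have sg2 : sg * sg = 1 by rewrite /sg -expr2 sqrr_sign.
(* Diagonal entries of the adjugate omit one diagonal variable; the entries [(ordS k, k)] omit one
   superdiagonal variable, up to the common sign [sg]. *)
have adjx k : \adj (Ymx K n) k k = omit_prod K x k.
  by rewrite adj_Ymx mxE; apply: eq_bigr => j _; rewrite /cyc_choice cdistnn //.
have adjy k : \adj (Ymx K n) (ordS k) k = sg * omit_prod K y k.
  have -> : sg = (-1) ^+ #|'I_n|.-1 by rewrite card_ord.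
  rewrite adj_Ymx mxE -omit_signed; apply: eq_bigr => j jk.
  rewrite /cyc_choice ifT // !cdist_ordS eqxx (negbTE jk).
  by have := cdist_lt k j; have : cdist k j != 0%N; [rewrite cdist_eq0 | lia].
have [N1 f1] : exists N, \tr (\adj (Ymx K n) *m N) = omit_prod K x k0.
  by exists (delta_mx k0 k0); rewrite mxtrace_adj_delta adjx.
have [N2 f2] : exists N, \tr (\adj (Ymx K n) *m N) = omit_sum K x.
  by exists 1%:M; rewrite mulmx1; apply: eq_bigr => k _; rewrite adjx.
have [N3 g1] : exists N, \tr (\adj (Ymx K n) *m N) = omit_prod K y k0.
  exists (sg *: delta_mx k0 (ordS k0)).
  by rewrite -scalemxAr mxtraceZ mxtrace_adj_delta adjy mulrA sg2 mul1r.
have [N4 g2] : exists N, \tr (\adj (Ymx K n) *m N) = omit_sum K y.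
  exists (\sum_k sg *: delta_mx k (ordS k)).
  rewrite mulmx_sumr (linear_sum (@mxtrace S n)); apply: eq_bigr => k _ /=.
  by rewrite -scalemxAr mxtraceZ mxtrace_adj_delta adjy mulrA sg2 mul1r.
pose J1 := addgen zero (omit_prod K x k0); pose J2 := addgen J1 (omit_sum K x).
pose J3 := addgen J2 (omit_prod K y k0).
have id0 : is_ideal zero := zero_is_ideal S.
have id1 : is_ideal J1 := addgen_is_ideal id0 _.
have id2 : is_ideal J2 := addgen_is_ideal id1 _.
have id3 : is_ideal J3 := addgen_is_ideal id2 _.
have fr0 i : free_of zero i by exact: free_of_zero.
(* The generators of [J2] involve diagonal variables alone. *)
have fr2 k : free_of J2 (y k).
  have nk j : ~~ pred1 (y k) (x j) by rewrite /= xy.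
  apply: free_of_addgen => //; first exact: kill_omit_sum.
  by apply: free_of_addgen => //; exact: kill_omit_prod.
have nz1 : nzd_mod zero (omit_prod K x k0) by exact: nzd_omit_prod.
have nz2 : nzd_mod J1 (omit_sum K x) by exact: nzd_omit_sum.
have nz3 : nzd_mod J2 (omit_prod K y k0) by exact: nzd_omit_prod.
have nz4 : nzd_mod J3 (omit_sum K y) by exact: nzd_omit_sum.
have ex4_1 : gn_ex4 (Ymx K n) J1 by apply: (@gn_ex4_step _ _ _ _ N2); rewrite ?f2.
have ex4_2 : gn_ex4 (Ymx K n) J2 by apply: (@gn_ex4_step _ _ _ _ N3); rewrite ?g1.
have ex4_3 : gn_ex4 (Ymx K n) J3 by apply: (@gn_ex4_step _ _ _ _ N4); rewrite ?g2.
have ex3_0 : gn_ex3 (Ymx K n) zero by apply: (@gn_ex3_step _ _ _ d0 _ N1); rewrite ?f1.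
have ex3_1 : gn_ex3 (Ymx K n) J1 by apply: (@gn_ex3_step _ _ _ d0 _ N2); rewrite ?f2.
have ex3_2 : gn_ex3 (Ymx K n) J2 by apply: (@gn_ex3_step _ _ _ d0 _ N3); rewrite ?g1.
have ex2_0 : gn_ex2 (Ymx K n) zero by apply: (@gn_ex2_step _ _ _ d0 _ N1 _ _ k0); rewrite ?f1.
have ex2_1 : gn_ex2 (Ymx K n) J1 by apply: (@gn_ex2_step _ _ _ d0 _ N2 _ _ k0); rewrite ?f2.
by split=> //; apply: (@gn_ex1_step _ _ _ d0 _ N1); rewrite ?f1.
Qed.

(** Interpolates between the generic matrix, at [pred0], and Y, at [inW]. *)
Definition gen_mx U : 'M[S]_n := map_mx (kill U) (generic_mx K n).
Definition inW : pred 'I_(n * n) := fun i => [exists v, (vidx n v == i) && ~~ inV n v].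

Lemma inW_vidx v : inW (vidx n v) = ~~ inV n v.
Proof.
apply/existsP/idP => [[w /andP[/eqP/vidx_inj ->]]//|Wv].
by exists v; rewrite eqxx.
Qed.

Lemma gen_mxE U i j : gen_mx U i j = if U (vidx n (i, j)) then 0 else xvar K n (i, j).
Proof. by rewrite !mxE killX. Qed.

Lemma gen_mx_inW : gen_mx inW = Ymx K n.
Proof. by apply/matrixP => i j; rewrite gen_mxE !mxE inW_vidx; case: (inV _ _). Qed.

Lemma gen_mx_pred0 : gen_mx pred0 = generic_mx K n.
Proof. by apply/matrixP => i j; rewrite gen_mxE !mxE. Qed.

Lemma kill_gen_mx U V : map_mx (kill U) (gen_mx V) = gen_mx (predU U V).
Proof. by apply/matrixP => i j; rewrite !mxE; exact: kill_kill. Qed.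

Lemma eq_gen_mx U V : U =1 V -> gen_mx U = gen_mx V.
Proof. by move=> UV; apply/matrixP => i j; rewrite !gen_mxE UV. Qed.

Lemma homog_gen_mx U i j : gen_mx U i j \is 1.-homog.
Proof. by rewrite gen_mxE; case: ifP => _; [exact: dhomog0 | exact: homogX]. Qed.

Lemma gn_gen_mx U : subpred U inW ->
  [/\ gn_ex1 (gen_mx U) zero, gn_ex2 (gen_mx U) zero & gn_ex3 (gen_mx U) zero].
Proof.
move=> UW; pose k0 : 'I_n := Ordinal (ltnW (ltnW n2)).
(* [s] lists variables still to be killed and may overlap [V]. At the empty list the matrix is Y. *)
suff H (s : seq 'I_(n * n)) V : (predU (mem s) V =1 inW) ->
    [/\ gn_ex1 (gen_mx V) zero, gn_ex2 (gen_mx V) zero & gn_ex3 (gen_mx V) zero].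
  apply: (H (enum inW)) => i /=; rewrite mem_enum.
  by apply/idP/idP => [/orP[//|/UW]|Wi] //; apply/orP; left.
elim: s V => [|i s IH] V HV.
  by rewrite (eq_gen_mx (V := inW)) ?gen_mx_inW //; exact: gn_Ymx.
have [|E1 E2 E3] := IH (predU (pred1 i) V).
  by move=> j; rewrite -HV /= !inE; case: (j == i); rewrite /= ?orbT.
rewrite -kill_gen_mx in E1 E2 E3.
split; [exact: (gn_ex1_deform (homog_gen_mx V) E1) | exact: (gn_ex2_deform (homog_gen_mx V) E2) |].
exact: (gn_ex3_deform (homog_gen_mx V) k0 E3).
Qed.

Lemma det_gen_mx_neq0 U : subpred U inW -> \det (gen_mx U) != 0.
Proof.
move=> UW; apply/eqP => /(congr1 (kill inW)); rewrite rmorph0 -det_map_mx kill_gen_mx.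
rewrite (eq_gen_mx (V := inW)); first by rewrite gen_mx_inW => /eqP; apply/negP; exact: det_Ymx_neq0.
by move=> i /=; case: (boolP (U i)) => [/UW ->|]; rewrite ?orbT ?orbF.
Qed.

End GenericMatrix.

(** * The minimal free resolution *)

Section ColumnMatrix.
Variables (A : comNzRingType) (a b : nat) (f : 'rV[A]_a -> 'rV[A]_b).

(** [min_graded_res] lets matrices act on columns, while [lin1_mx] acts on rows. *)
Definition col_mx_of : 'M[A]_(b, a) := (lin1_mx f)^T.

Hypothesis lf : linear f.
HB.instance Definition _ := GRing.isLinear.Build A 'rV[A]_a 'rV[A]_b _ f lf.

Lemma mul_col_mx_of v : col_mx_of *m v = (f v^T)^T.
Proof. by rewrite -mul_rV_lin1 trmx_mul trmxK. Qed.

End ColumnMatrix.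

Section TracePairs.
Variables (A : comNzRingType) (n : nat) (i0 : 'I_n).
Notation q := (n * n).-1.
Let k0 := mxvec_index i0 i0.
Implicit Types (P Q : 'M[A]_n).

(** A resolution needs bases, but the middle module is a subquotient of pairs of matrices. Dropping
    the entry [(i0, i0)] leaves [n^2 - 1] coordinates for each component. *)
Definition shave P : 'rV[A]_q := \row_k mxvec P 0 (lift k0 k).
Definition unshave (v : 'rV[A]_q) : 'M[A]_n :=
  \matrix_(i, j) oapp (v 0) 0 (unlift k0 (mxvec_index i j)).

(* Coordinates on {(P, Q) | tr P = tr Q} / (1, 1): normalize P i0 i0 to 0 and
   recover Q i0 i0 from the trace condition. *)
Definition enc P Q : 'rV[A]_(q + q) :=
  row_mx (shave (P - (P i0 i0)%:M)) (shave (Q - (P i0 i0)%:M)).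
Definition dec1 (w : 'rV[A]_(q + q)) := unshave (lsubmx w).
Definition dec2 (w : 'rV[A]_(q + q)) := unshave (rsubmx w) +
  (\tr (unshave (lsubmx w)) - \tr (unshave (rsubmx w))) *: delta_mx i0 i0.

Lemma unshaveP c v w : unshave (c *: v + w) = c *: unshave v + unshave w.
Proof. by apply/matrixP => i j; rewrite !mxE; case: unlift => [k|] /=; rewrite ?mxE // mulr0 addr0. Qed.

Lemma shaveP c P Q : shave (c *: P + Q) = c *: shave P + shave Q.
Proof. by apply/matrixP => i j; rewrite !mxE linearP /= !mxE. Qed.

Lemma shaveK v : shave (unshave v) = v.
Proof.
apply/matrixP => i k; rewrite ord1 mxE.
case: (mxvec_indexP (lift k0 k)) (liftK k0 k) => a b; rewrite mxvecE mxE => ->.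
by [].
Qed.

Lemma unshaveK P : unshave (shave P) = P - P i0 i0 *: delta_mx i0 i0.
Proof.
have k0E i j : (k0 == mxvec_index i j) = (i == i0) && (j == i0).
  apply/eqP/andP => [|[/eqP -> /eqP ->]] //; rewrite /k0.
  by move/(bij_inj (onT_bij (curry_mxvec_bij n n)) (x1 := (i0, i0)) (x2 := (i, j))) => [<- <-].
apply/matrixP => i j; rewrite !mxE; case: unliftP => [k E|E] /=.
  rewrite mxE -E mxvecE -k0E E (negbTE (neq_lift _ _)) mulr0 subr0 //.
have := k0E i j; rewrite E eqxx => /esym/andP[/eqP -> /eqP ->].
by rewrite !eqxx mulr1 subrr.
Qed.

Lemma unshave00 v : unshave v i0 i0 = 0.
Proof. by rewrite mxE unlift_none. Qed.

Lemma shave_delta : shave (delta_mx i0 i0) = 0.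
Proof.
apply/matrixP => i k; rewrite !mxE; case: (mxvec_indexP (lift k0 k)) (neq_lift k0 k) => a b H.
rewrite mxvecE mxE; case: eqP => //= Ea; case: eqP => //= Eb.
by rewrite Ea Eb eqxx in H.
Qed.

Lemma mxtrace_delta : \tr (delta_mx i0 i0 : 'M[A]_n) = 1.
Proof. by rewrite /mxtrace (bigD1 i0) //= mxE eqxx big1 ?addr0 // => i /negbTE; rewrite mxE => ->. Qed.

Lemma mxtrace_dec w : \tr (dec1 w) = \tr (dec2 w).
Proof. by rewrite /dec1 /dec2 mxtraceD mxtraceZ mxtrace_delta; ring. Qed.

Lemma decK w : enc (dec1 w) (dec2 w) = w.
Proof.
rewrite /enc unshave00 raddf0 !subr0 shaveK /dec2 addrC shaveP shave_delta scaler0 add0r shaveK.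
exact: hsubmxK.
Qed.

Lemma enc1K P Q : dec1 (enc P Q) = P - (P i0 i0)%:M.
Proof. by rewrite /dec1 row_mxKl unshaveK !mxE eqxx mulr1n subrr scale0r subr0. Qed.

Lemma enc2K P Q : \tr P = \tr Q -> dec2 (enc P Q) = Q - (P i0 i0)%:M.
Proof.
move=> PQ; rewrite /dec2 row_mxKl row_mxKr !unshaveK !raddfB /= !mxtraceZ mxtrace_delta.
rewrite PQ [(P - _) _ _]mxE [(- _%:M) _ _]mxE [_%:M _ _]mxE eqxx mulr1n subrr mul0r subr0.
set a := (Q - _) i0 i0; apply/matrixP => i j; rewrite !mxE; ring.
Qed.

Lemma encP c P1 Q1 P2 Q2 :
  enc (c *: P1 + P2) (c *: Q1 + Q2) = c *: enc P1 Q1 + enc P2 Q2.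
Proof.
rewrite /enc scale_row_mx add_row_mx; congr row_mx.
  have <- := shaveP c (P1 - (P1 i0 i0)%:M) (P2 - (P2 i0 i0)%:M); apply: (congr1 shave).
  by apply/matrixP => i j; rewrite !mxE; case: (i == j); rewrite ?mulr1n ?mulr0n; ring.
have <- := shaveP c (Q1 - (P1 i0 i0)%:M) (Q2 - (P2 i0 i0)%:M); apply: (congr1 shave).
by apply/matrixP => i j; rewrite !mxE; case: (i == j); rewrite ?mulr1n ?mulr0n; ring.
Qed.

Lemma enc_scalar s : enc s%:M s%:M = 0.
Proof.
have E : s%:M - (s%:M i0 i0)%:M = 0 :> 'M[A]_n by rewrite [s%:M _ _]mxE eqxx mulr1n subrr.
rewrite /enc E.
have -> : shave 0 = 0 by apply/matrixP => i j; rewrite !mxE linear0 mxE.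
by rewrite row_mx0.
Qed.

Lemma encDscalar P Q s : enc (P + s%:M) (Q + s%:M) = enc P Q.
Proof. by have := encP 1 P Q s%:M s%:M; rewrite !scale1r enc_scalar addr0. Qed.

Lemma dec1P c v w : dec1 (c *: v + w) = c *: dec1 v + dec1 w.
Proof. by rewrite /dec1 linearP /= unshaveP. Qed.

Lemma dec2P c v w : dec2 (c *: v + w) = c *: dec2 v + dec2 w.
Proof.
rewrite /dec2 !linearP /= !unshaveP !linearP /=.
by apply/matrixP => i j; rewrite !mxE; ring.
Qed.

End TracePairs.

Section Resolution.
Variables (K : fieldType) (n : nat).
Notation S := {mpoly K[n * n]}.

Lemma is_homogP d (p : S) : p \is d.-homog -> is_homog K n d p.
Proof. by move/dhomogP. Qed.

Definition four_term (s0 s1 s2 s3 : seq nat) (i : nat) : seq nat :=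
  match i with 0 => s0 | 1 => s1 | 2 => s2 | 3 => s3 | _ => [::] end%N.

(** Each module is generated in one degree. Sizes are given by equations so that the matrices keep
    their natural dimensions without casts. *)
Lemma min_graded_res_four J (s0 s1 s2 s3 : seq nat) (m0 m1 m2 m3 d0 d1 d2 d3 : nat)
  (G : 'rV[S]_m0) (D0 : 'M[S]_(m0, m1)) (D1 : 'M[S]_(m1, m2)) (D2 : 'M[S]_(m2, m3)) :
  m0 = size s0 -> m1 = size s1 -> m2 = size s2 -> m3 = size s3 ->
  all (pred1 d0) s0 -> all (pred1 d1) s1 -> all (pred1 d2) s2 -> all (pred1 d3) s3 ->
  (d0 < d1)%N -> (d1 < d2)%N -> (d2 < d3)%N ->
  (forall k, G 0 k \is d0.-homog) -> (forall k l, D0 k l \is (d1 - d0).-homog) ->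
  (forall k l, D1 k l \is (d2 - d1).-homog) -> (forall k l, D2 k l \is (d3 - d2).-homog) ->
  (forall p, J p <-> exists u : 'cV_m0, p = (G *m u) 0 0) ->
  (forall v : 'cV_m0, G *m v = 0 <-> exists u, v = D0 *m u) ->
  (forall v : 'cV_m1, D0 *m v = 0 <-> exists u, v = D1 *m u) ->
  (forall v : 'cV_m2, D1 *m v = 0 <-> exists u, v = D2 *m u) ->
  (forall v : 'cV_m3, D2 *m v = 0 -> v = 0) ->
  exists g D, min_graded_res K n J (four_term s0 s1 s2 s3) g D.
Proof.
move=> E0 E1 E2 E3; subst m0 m1 m2 m3.
move=> a0 a1 a2 a3 lt01 lt12 lt23 hG h0 h1 h2 JG ex0 ex1 ex2 ex3.
pose a := four_term s0 s1 s2 s3.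
pose D i : 'M[S]_(size (a i), size (a i.+1)) :=
  match i return 'M[S]_(size (a i), size (a i.+1)) with
  | 0%N => D0 | 1%N => D1 | 2%N => D2 | _ => 0 end.
have nthE s d k : all (pred1 d) s -> (k < size s)%N -> nth 0%N s k = d.
  by move=> /allP H ks; apply/eqP/H; rewrite mem_nth.
have const0 d (p : S) : (0 < d)%N -> p \is d.-homog -> p@_0%MM = 0.
  move=> d0' hp; apply: (dhomog_nemf_coeff hp); rewrite /= mdeg0.
  by rewrite eq_sym -lt0n.
exists G, D; split; last split; last split; last split; last split; last split.
- move=> k; split; last by rewrite (nthE _ d0) //; exact/is_homogP.
  apply/JG; exists (delta_mx k 0); rewrite mxE (bigD1 k) //= !mxE !eqxx mulr1.
  by rewrite big1 ?addr0 // => j /negbTE jk; rewrite !mxE jk mulr0.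
- exact: JG.
- exact: ex0.
- move=> [|[|[|i]]] v /=; [exact: ex1 | exact: ex2 | |].
  + split=> [/ex3 ->|[u ->]]; first by exists 0; rewrite mul0mx.
    by rewrite mul0mx mulmx0.
  + by split=> _; [exists 0; apply/matrixP; case | rewrite mul0mx].
- move=> [|[|[|i]]] k l /=; [| | |by left; rewrite mxE].
  + by right; rewrite (nthE _ d0) // (nthE _ d1) //; split; [exact: ltnW | exact/is_homogP].
  + by right; rewrite (nthE _ d1) // (nthE _ d2) //; split; [exact: ltnW | exact/is_homogP].
  + by right; rewrite (nthE _ d2) // (nthE _ d3) //; split; [exact: ltnW | exact/is_homogP].
- move=> [|[|[|i]]] k l /=; [| | |by rewrite mxE mcoeff0].
  + by apply: const0 (h0 _ _); rewrite subn_gt0.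
  + by apply: const0 (h1 _ _); rewrite subn_gt0.
  + by apply: const0 (h2 _ _); rewrite subn_gt0.
- by exists 3; move=> [|[|[|[|i]]]].
Qed.

(** Linear maps in the middle and cofactors at both ends give the degrees [n - 1], [n], [n + 1] and
    [2n], whatever the matrix. *)
Definition gn_degrees : nat -> seq nat :=
  four_term (nseq (n * n) n.-1) (nseq ((n * n).-1 + (n * n).-1) n)
    (nseq (n * n) n.+1) [:: (n.+1 + n.-1)%N].

Definition homog_mx d a b (M : 'M[S]_(a, b)) := forall i j, M i j \is d.-homog.

Lemma homog_mx_mul d e a b c (P : 'M_(a, b)) (Q : 'M_(b, c)) :
  homog_mx d P -> homog_mx e Q -> homog_mx (d + e) (P *m Q).
Proof. by move=> hP hQ i j; rewrite mxE; apply: rpred_sum => k _; apply: dhomogM. Qed.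

Lemma homog_mxB d a b (P Q : 'M_(a, b)) : homog_mx d P -> homog_mx d Q -> homog_mx d (P - Q).
Proof. by move=> hP hQ i j; rewrite !mxE; apply: rpredB. Qed.

Lemma homog_mxD d a b (P Q : 'M_(a, b)) : homog_mx d P -> homog_mx d Q -> homog_mx d (P + Q).
Proof. by move=> hP hQ i j; rewrite !mxE; apply: rpredD. Qed.

Lemma homog_scalar d a (s : S) : s \is d.-homog -> homog_mx d (s%:M : 'M_a).
Proof. by move=> hs i j; rewrite mxE; case: eqP => _; [rewrite mulr1n | exact: dhomog0]. Qed.

Lemma homog_mxtrace d a (P : 'M_a) : homog_mx d P -> \tr P \is d.-homog.
Proof. by move=> hP; apply: rpred_sum => i _; exact: hP. Qed.

Lemma homog_delta a b (i : 'I_a) (j : 'I_b) : homog_mx 0 (delta_mx i j).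
Proof. by move=> k l; rewrite mxE; case: (_ && _); [exact: dhomog1 | exact: dhomog0]. Qed.

Lemma homog_mxvec d a b (P : 'M_(a, b)) : homog_mx d P -> homog_mx d (mxvec P).
Proof. by move=> hP i j; rewrite ord1; case/mxvec_indexP: j => k l; rewrite mxvecE. Qed.

Lemma homog_vec_mx d a b (v : 'rV_(a * b)) : homog_mx d v -> homog_mx d (vec_mx v : 'M_(a, b)).
Proof. by move=> hv i j; rewrite mxE. Qed.

Variable i0 : 'I_n.

Lemma homog_shave d (P : 'M_n) : homog_mx d P -> homog_mx d (shave i0 P).
Proof. by move=> hP i j; rewrite mxE; apply: homog_mxvec. Qed.

Lemma homog_unshave d v : homog_mx d v -> homog_mx d (unshave i0 v).
Proof. by move=> hv i j; rewrite mxE; case: unlift => [k|] //=; exact: dhomog0. Qed.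

Lemma homog_col_mx_of d a b (f : 'rV[S]_a -> 'rV[S]_b) :
  (forall l, homog_mx d (f (delta_mx 0 l))) -> homog_mx d (col_mx_of f).
Proof. by move=> H i j; rewrite !mxE -[X in f X]/(delta_mx 0 j); exact: H. Qed.

Variable M : 'M[S]_n.
Hypotheses (n1 : (1 < n)%N) (homogM : homog_mx 1 M) (detM : \det M != 0).
Let zero := @zero_ideal S.
Hypotheses (ex1 : gn_ex1 M zero) (ex2 : gn_ex2 M zero) (ex3 : gn_ex3 M zero).
Variable J : S -> Prop.
Hypothesis JE : forall p, J p <-> exists Z, p = \tr (\adj M *m Z).

Let f0 (u : 'rV[S]_(n * n)) : 'rV[S]_1 := (\tr (\adj M *m vec_mx u))%:M.
Let f1 (w : 'rV[S]_((n * n).-1 + (n * n).-1)) : 'rV[S]_(n * n) :=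
  mxvec (dec1 i0 w *m M - M *m dec2 i0 w).
Let f2 (u : 'rV[S]_(n * n)) := enc i0 (M *m vec_mx u) (vec_mx u *m M).
Let f3 (c : 'rV[S]_1) : 'rV[S]_(n * n) := mxvec (c 0 0 *: \adj M).

Let lf0 : linear f0.
Proof. by move=> c u v; rewrite /f0 linearP /= mulmxDr -scalemxAr linearP /= raddfD /= scale_scalar_mx. Qed.
Let lf1 : linear f1.
Proof.
move=> c u v; rewrite /f1 dec1P dec2P mulmxDl mulmxDr -scalemxAl -scalemxAr.
have mxvecP (P Q : 'M[S]_n) : mxvec (c *: P + Q) = c *: mxvec P + mxvec Q by exact: linearP.
by rewrite -mxvecP scalerBr opprD addrACA.
Qed.
Let lf2 : linear f2.
Proof. by move=> c u v; rewrite /f2 linearP /= mulmxDl mulmxDr -scalemxAl -scalemxAr encP. Qed.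
Let lf3 : linear f3.
Proof. by move=> c u v; rewrite /f3 !mxE scalerDl -scalerA linearP. Qed.

Lemma gulliksen_negard_resolution : exists g D, min_graded_res K n J gn_degrees g D.
Proof.
have cM a b f (lf : linear f) (v : 'cV[S]_a) (w : 'cV[S]_b) : (col_mx_of f *m v = w) <-> f v^T = w^T.
  by rewrite mul_col_mx_of //; split=> [<-|->]; rewrite trmxK.
apply: (@min_graded_res_four J _ _ _ _ _ _ _ _ n.-1 n n.+1 (n.+1 + n.-1)
   (col_mx_of f0) (col_mx_of f1) (col_mx_of f2) (col_mx_of f3));
  rewrite ?size_nseq ?all_nseq /= ?eqxx ?orbT //.
- by rewrite prednK // ltnW.
- by rewrite -[X in (X < _)%N]addn0 ltn_add2l; case: n n1 => [|[]].
- move=> k; apply: homog_col_mx_of => l; rewrite -[n.-1]addn0; apply: homog_scalar.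
  apply/homog_mxtrace/homog_mx_mul; first exact: homog_adj.
  exact/homog_vec_mx/homog_delta.
- have -> : (n - n.-1 = 1)%N by lia.
  move=> k l; apply: homog_col_mx_of => {}l; apply/homog_mxvec/homog_mxB.
    apply: (@homog_mx_mul 0 1) => //; apply: homog_unshave => i j.
    by rewrite mxE; exact: homog_delta.
  apply: (@homog_mx_mul 1 0) => //; rewrite /dec2.
  have hl : homog_mx 0 (unshave i0 (lsubmx (delta_mx 0 l))).
    by apply: homog_unshave => i j; rewrite mxE; exact: homog_delta.
  have hr : homog_mx 0 (unshave i0 (rsubmx (delta_mx 0 l))).
    by apply: homog_unshave => i j; rewrite mxE; exact: homog_delta.
  apply: homog_mxD => // i j; rewrite mxE; apply: (@dhomogM _ _ _ 0 _ 0); last exact: homog_delta.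
  by apply: rpredB; exact: homog_mxtrace.
- have -> : (n.+1 - n = 1)%N by lia.
  move=> k l; apply: homog_col_mx_of => {}l.
  have hv : homog_mx 0 (vec_mx (delta_mx 0 l) : 'M_n) by exact/homog_vec_mx/homog_delta.
  have hL : homog_mx 1 (M *m vec_mx (delta_mx 0 l)).
    exact: (@homog_mx_mul 1 0).
  have hR : homog_mx 1 (vec_mx (delta_mx 0 l) *m M).
    exact: (@homog_mx_mul 0 1).
  move=> i j; rewrite /f2 /enc mxE.
  by case: split => k'; apply: homog_shave; apply: homog_mxB => //; exact: homog_scalar.
- have -> : (n.+1 + n.-1 - n.+1 = n.-1)%N by lia.
  move=> k l; apply: homog_col_mx_of => {}l; apply: homog_mxvec => i j.
  rewrite mxE -[n.-1]add0n; apply: dhomogM; [exact: homog_delta | exact: homog_adj].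
- move=> p; rewrite JE; split=> [[Z ->]|[u ->]].
    by exists (mxvec Z)^T; rewrite mul_col_mx_of // trmxK /f0 mxvecK !mxE eqxx mulr1n.
  by exists (vec_mx u^T); rewrite mul_col_mx_of // /f0 !mxE eqxx mulr1n.
- move=> v; rewrite cM // trmx0; split=> [|[u /esym/cM]].
    move=> /matrixP/(_ 0 0); rewrite !mxE eqxx mulr1n => /ex1[P [Q [/subr0_eq PQ /mxin_zeroB E]]].
    exists (enc i0 P Q)^T; apply/esym/cM => //; rewrite trmxK /f1 enc1K enc2K //.
    rewrite mulmxBl mulmxBr mul_scalar_mx mul_mx_scalar opprB addrA subrK -E.
    by rewrite vec_mxK.
  move=> /(_ lf1) <-; rewrite /f0 /f1 mxvecK mxtrace_adj_cycle ?raddf0 //.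
  exact: mxtrace_dec.
- move=> v; rewrite cM // trmx0; split=> [|[u /esym/cM]].
    rewrite /f1 => /eqP; rewrite mxvec_eq0 => /eqP E.
    have [||Z [s [/mxin_zeroB E1 /mxin_zeroB E2]]] := ex2 (P := dec1 i0 v^T) (Q := dec2 i0 v^T).
    + by rewrite mxtrace_dec; exact: subrr.
    + by rewrite E; apply/mxin_zeroP.
    exists (mxvec Z)^T; apply/esym/cM => //; rewrite trmxK /f2 mxvecK -(encDscalar _ _ _ s) -E1 -E2.
    exact: decK.
  move=> /(_ lf2) <-; rewrite /f1 /f2 enc1K enc2K; last by rewrite mxtrace_mulC.
  by rewrite mulmxBl mulmxBr mul_scalar_mx mul_mx_scalar mulmxA subrr linear0.
- move=> v; rewrite cM // trmx0; split=> [|[u /esym/cM]].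
    rewrite /f2; set Z := vec_mx _ => E.
    have F1 := enc1K i0 (M *m Z) (Z *m M).
    have F2 := enc2K i0 (P := M *m Z) (Q := Z *m M) (mxtrace_mulC _ _).
    have d10 : dec1 i0 (0 : 'rV[S]_((n * n).-1 + (n * n).-1)) = 0.
      by have := dec1P i0 (-1) (0 : 'rV[S]_((n * n).-1 + (n * n).-1)) 0; rewrite scaler0 addr0 scaleN1r addNr.
    have d20 : dec2 i0 (0 : 'rV[S]_((n * n).-1 + (n * n).-1)) = 0.
      by have := dec2P i0 (-1) (0 : 'rV[S]_((n * n).-1 + (n * n).-1)) 0; rewrite scaler0 addr0 scaleN1r addNr.
    rewrite E d10 in F1; rewrite E d20 in F2.
    have [||c /mxin_zeroB Ec] := ex3 (Z := Z) (s := (M *m Z) i0 i0).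
    + by apply/mxin_zeroP.
    + by apply/mxin_zeroP.
    exists c%:M; apply/esym/cM => //.
    by rewrite tr_scalar_mx /f3 mxE eqxx mulr1n -Ec /Z vec_mxK.
  move=> /(_ lf3) <-; rewrite /f2 /f3 mxvecK -scalemxAl -scalemxAr mul_mx_adj mul_adj_mx.
  by rewrite scale_scalar_mx enc_scalar.
(* Injectivity at the left end: [\adj M = 0] would make [\det M] vanish. *)
- move=> v; rewrite cM // trmx0 /f3 => /eqP; rewrite mxvec_eq0 scalemx_eq0 => /orP[/eqP|/eqP E].
    by move=> E; apply/matrixP => i j; rewrite !ord1 mxE -E mxE.
  case/eqP: detM; have := congr1 (fun T => (T *m M) i0 i0) E.
  by rewrite mul_adj_mx mul0mx !mxE eqxx mulr1n.
Qed.

End Resolution.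

(** * Specialization and initial ideal *)

Lemma incr_lift n (i : 'I_n) : incr n [ffun k => lift i k].
Proof.
apply/forallP => a; apply/forallP => b; apply/implyP => ab; rewrite !ffunE /= /bump.
by case: (leqP i a) => ?; case: (leqP i b) => ?; lia.
Qed.

(** The image misses one value [i], and an increasing map is determined by its image. *)
Lemma incr_liftP n (f : {ffun 'I_n.-1 -> 'I_n}) : (0 < n)%N -> incr n f ->
  exists i, f = [ffun k => lift i k].
Proof.
move=> n0 /forallP incf.
have mono (g : {ffun 'I_n.-1 -> 'I_n}) : incr n g -> sorted ltn [seq val (g k) | k <- enum 'I_n.-1].
  move=> /forallP ig; rewrite sorted_map.
  have : sorted ltn (map val (enum 'I_n.-1)) by rewrite val_enum_ord iota_ltn_sorted.
  rewrite sorted_map; apply: sub_sorted => a b /= ab.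
  by have /forallP/(_ b)/implyP/(_ ab) := ig a.
have injf : injective f.
  move=> a b fab; apply: val_inj; case: (ltngtP a b) => // ab.
    by have /forallP/(_ b)/implyP/(_ ab) := incf a; rewrite fab ltnn.
  by have /forallP/(_ a)/implyP/(_ ab) := incf b; rewrite fab ltnn.
have [i iNf] : exists i, i \notin codom f.
  apply/existsP; rewrite -negb_forall; apply/negP => /forallP H.
  have := card_codom injf; rewrite (eq_card (B := 'I_n)) ?card_ord; first by lia.
  by move=> x; rewrite !inE; exact: H.
exists i; pose g := [ffun k => lift i k].
have codE : codom f =i codom g.
  have sub : codom f \subset predC1 i.
    by apply/subsetP => x xf; rewrite inE; apply: contraNneq iNf => <-.
  have injg : injective g by move=> a b; rewrite !ffunE => /lift_inj.
  have sub' : codom g \subset predC1 i.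
    by apply/subsetP => x /codomP[k ->]; rewrite !inE ffunE eq_sym neq_lift.
  have cC : #|predC1 i| = n.-1 by rewrite cardC1 card_ord.
  have Ef : #|codom f| = #|predC1 i| by rewrite card_codom // cC card_ord.
  have Eg : #|codom g| = #|predC1 i| by rewrite card_codom // cC card_ord.
  by move=> x; rewrite (subset_cardP Ef sub) (subset_cardP Eg sub').
have E : [seq val (f k) | k <- enum 'I_n.-1] = [seq val (g k) | k <- enum 'I_n.-1].
  apply: (irr_sorted_eq ltn_trans ltnn); [exact/mono/forallP | exact/mono/incr_lift |].
  move=> x; apply/mapP/mapP => -[k _ ->].
    have /codomP[l ->] : f k \in codom g by rewrite -codE codom_f.
    by exists l; rewrite ?mem_enum.
  have /codomP[l ->] : g k \in codom f by rewrite codE codom_f.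
  by exists l; rewrite ?mem_enum.
apply/ffunP => k; apply: val_inj.
by move/eq_in_map: E => /(_ k); apply; rewrite mem_enum.
Qed.

Section IdealGen.
Variables (K : fieldType) (n : nat).
Notation S := {mpoly K[n * n]}.
Implicit Types (s : seq S) (J : S -> Prop) (p : S).

Lemma ideal_gen_ideal s : is_ideal (ideal_gen K n s).
Proof.
split=> [|a b [c ->] [d ->]|e a [c ->]].
- by exists (fun _ => 0); rewrite big1 // => k _; rewrite mul0r.
- exists (fun k => c k + d k); rewrite -big_split; apply: eq_bigr => k _; rewrite mulrDl //.
- by exists (fun k => e * c k); rewrite mulr_sumr; apply: eq_bigr => k _; rewrite mulrA.
Qed.

Lemma mem_ideal_gen s p : p \in s -> ideal_gen K n s p.
Proof.
move=> ps; have H : (index p s < size s)%N by rewrite index_mem.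
exists (fun k => (k == Ordinal H)%:R); rewrite (bigD1 (Ordinal H)) //= eqxx mul1r nth_index //.
by rewrite big1 ?addr0 // => k /negbTE ->; rewrite mul0r.
Qed.

Lemma ideal_gen_min s J : is_ideal J -> (forall p, p \in s -> J p) ->
  forall p, ideal_gen K n s p -> J p.
Proof.
move=> idJ H p [c ->]; apply: ideal_sum => // k _; apply: idealMl => //.
by apply: H; rewrite mem_nth.
Qed.

(** The ideal of minors, as the image of the map whose kernel [gn_ex1] describes. *)
Definition adj_ideal (M : 'M[S]_n) : S -> Prop := fun p => exists Z, p = \tr (\adj M *m Z).

Lemma adj_ideal_ideal M : is_ideal (adj_ideal M).
Proof.
split=> [|a b [Y ->] [Z ->]|c a [Z ->]].
- by exists 0; rewrite mulmx0 raddf0.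
- by exists (Y + Z); rewrite mulmxDr raddfD.
- by exists (c *: Z); rewrite -scalemxAr mxtraceZ.
Qed.

Lemma adj_ideal_entry M j i : adj_ideal M (\adj M j i).
Proof. by exists (delta_mx i j); rewrite mxtrace_adj_delta. Qed.

Lemma adj_ideal_min M J : is_ideal J -> (forall j i, J (\adj M j i)) ->
  forall p, adj_ideal M p -> J p.
Proof.
move=> idJ H p [Z ->]; apply: ideal_sum => // j _; rewrite mxE.
by apply: ideal_sum => // i _; apply: idealMr.
Qed.

Lemma minor_of_lift M i j :
  minor_of K n M ([ffun k => lift i k], [ffun k => lift j k]) = (-1) ^+ (i + j) * \adj M j i.
Proof.
rewrite mxE /cofactor mulrA -expr2 sqrr_sign mul1r; congr (\det _).
by apply/matrixP => a b; rewrite !mxE /= !ffunE.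
Qed.

Lemma minors_adj_ideal M p : (0 < n)%N -> ideal_gen K n (minors K n M) p <-> adj_ideal M p.
Proof.
move=> n0; split.
  apply: ideal_gen_min; first exact: adj_ideal_ideal.
  move=> _ /mapP[[f g] + ->]; rewrite mem_enum inE /= => /andP[/(incr_liftP n0)[i ->] /(incr_liftP n0)[j ->]].
  rewrite minor_of_lift; apply: idealMl; [exact: adj_ideal_ideal | exact: adj_ideal_entry].
apply: adj_ideal_min; first exact: ideal_gen_ideal.
move=> j i; have -> : \adj M j i = (-1) ^+ (i + j) *
    minor_of K n M ([ffun k => lift i k], [ffun k => lift j k]).
  by rewrite minor_of_lift mulrA -expr2 sqrr_sign mul1r.
apply: idealMl; first exact: ideal_gen_ideal.
by apply/mem_ideal_gen/map_f; rewrite mem_enum inE /= !incr_lift.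
Qed.

End IdealGen.

Lemma kill_eq0_in (K : fieldType) N (J : {mpoly K[N]} -> Prop) (U : pred 'I_N) p : is_ideal J ->
  (forall i, U i -> J 'X_i) -> kill U p = 0 -> J p.
Proof.
move=> idJ JU kp; rewrite (mpolyE p) big_seq; apply: ideal_sum => // m mp.
rewrite -mul_mpolyC; apply: idealMl => //.
case: (boolP (avoids U m)) => [Um|].
  have : (kill U p)@_m = p@_m by rewrite mcoeff_kill Um.
  by rewrite kp mcoeff0 => /esym/eqP; rewrite mcoeff_eq0 mp.
rewrite negb_forall => /existsP[i]; rewrite negb_imply => /andP[Ui mi].
rewrite -(submK (m := U_(i)%MM) (m' := m)) ?lep1mP // mpolyXD.
by apply: idealMl => //; exact: JU.
Qed.

Section RegularSequence.
Variables (K : fieldType) (n : nat).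
Hypothesis n2 : (2 < n)%N.
Notation S := {mpoly K[n * n]}.
Notation X := (generic_mx K n).

Lemma kill_adj_ideal (U V : pred 'I_(n * n)) p : adj_ideal (gen_mx K V) p ->
  adj_ideal (gen_mx K (predU U V)) (kill U p).
Proof.
case=> Z ->; exists (map_mx (kill U) Z).
by rewrite -mxtrace_map map_mxM map_mx_adj kill_gen_mx.
Qed.

(** Modulo some variables the ring is a polynomial ring in the others, and the minors become those
    of the specialized matrix. *)
Lemma minors_vars_mem (U : seq ('I_n * 'I_n)) p :
  ideal_gen K n (minors K n X ++ map (xvar K n) U) p <->
  adj_ideal (gen_mx K (mem (map (vidx n) U))) (kill (mem (map (vidx n) U)) p).
Proof.
have n0 : (0 < n)%N by lia.
set V := mem _; have VV : predU V V =1 V by move=> i /=; rewrite orbb.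
have XV Z : \tr (\adj (gen_mx K V) *m map_mx (kill V) Z) = kill V (\tr (\adj X *m Z)).
  by rewrite -mxtrace_map map_mxM map_mx_adj.
have idL := ideal_gen_ideal (minors K n X ++ map (xvar K n) U).
split.
  apply: (ideal_gen_min (J := fun p => adj_ideal (gen_mx K V) (kill V p))).
    have [I0 ID IM] := adj_ideal_ideal (gen_mx K V).
    by split=> [|a b|c a]; rewrite ?rmorph0 // ?rmorphD ?rmorphM; [exact: ID | exact: IM].
  move=> q; rewrite mem_cat => /orP[/mem_ideal_gen/minors_adj_ideal|/mapP[v vU ->]].
    by case=> // Z ->; rewrite -XV; eexists.
  rewrite killX ifT; first by case: (adj_ideal_ideal (gen_mx K V)).
  by apply/mapP; exists v.
case=> Z E; pose q := \tr (\adj X *m Z).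
have -> : p = q + (p - q) by rewrite addrC subrK.
apply: idealD => //.
  have : ideal_gen K n (minors K n X) q.
    by apply/(minors_adj_ideal X q n0); exact: (ex_intro _ Z erefl).
  apply: ideal_gen_min => [|t tm]; first exact: idL.
  by apply: mem_ideal_gen; rewrite mem_cat tm.
apply: (kill_eq0_in (U := V)) => //.
  move=> _ /mapP[v vU ->]; apply: (mem_ideal_gen (p := xvar K n v)).
  by rewrite mem_cat map_f // orbT.
rewrite rmorphB /= -XV; apply/eqP; rewrite subr_eq0; apply/eqP.
rewrite -[LHS](kill_idem V) E -mxtrace_map map_mxM map_mx_adj kill_gen_mx (eq_gen_mx K VV) //.
Qed.

(** Once the earlier variables are set to zero, each step is an instance of [gn_ex1_regular]. *)
Lemma regular_seq_W : regular_seq_mod K n (minors K n X) (Wvars K n).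
Proof.
have n0 : (0 < n)%N by lia.
set vs := enum [pred v : 'I_n * 'I_n | ~~ inV n v].
have WE : Wvars K n = map (xvar K n) vs by [].
split=> [k|].
  rewrite WE size_map => ks g; rewrite -map_take.
  have v0 : 'I_n * 'I_n by exact: (Ordinal n0, Ordinal n0).
  rewrite (nth_map v0) // => /minors_vars_mem H; apply/minors_vars_mem.
  set v := nth v0 vs k in H; set U := map _ (take k vs) in H *.
  have vU : vidx n v \notin U.
    rewrite (mem_map (@vidx_inj n)).
    have : uniq (take k.+1 vs) by rewrite take_uniq // enum_uniq.
    by rewrite (take_nth v0) // rcons_uniq => /andP[].
  move: H; rewrite rmorphM /= /xvar killX ifF; last exact: negbTE vU.
  rewrite mulrC => -[Z EZ].
  have inWs w : w \in vs -> inW (vidx n w) by rewrite mem_enum inE inW_vidx.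
  have UvW : subpred (predU (pred1 (vidx n v)) (mem U)) (@inW n).
    move=> i /= /orP[/eqP ->|/mapP[w /mem_take wU ->]]; last exact: inWs.
    by apply: inWs; apply: mem_nth.
  have [ex1 _ _] := gn_gen_mx K n2 UvW.
  rewrite -kill_gen_mx in ex1.
  exact: (gn_ex1_regular ex1 EZ).
(* Properness: every generator has constant term 0. *)
move=> /(@ideal_gen_min _ _ _ (fun p => p@_0%MM = 0)) H.
suff : (1 : S)@_0%MM = 0 by rewrite mcoeff1 eqxx => /eqP; rewrite oner_eq0.
apply: H.
  split=> [|a b Ha Hb|c a Ha]; rewrite ?mcoeff0 ?mcoeffD ?Ha ?Hb ?addr0 //.
  by rewrite (rmorphM (mcoeff 0%MM)) /= Ha mulr0.
move=> p; rewrite mem_cat => /orP[/mem_ideal_gen/minors_adj_ideal|/mapP[v _ ->]].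
  case=> // Z ->; rewrite -(mxtrace_map (mcoeff 0%MM)) map_mxM.
  have -> : map_mx (mcoeff 0%MM) (\adj X) = 0.
    apply/matrixP => i j; rewrite mxE [RHS]mxE.
    have h : \adj X i j \is (n.-1).-homog.
      by apply: homog_adj => a b; rewrite -gen_mx_pred0; exact: homog_gen_mx.
    by apply: (dhomog_nemf_coeff h); rewrite /= mdeg0; lia.
  by rewrite mul0mx raddf0.
by rewrite /xvar mcoeffX; case: eqP => // /(congr1 (@mdeg _)); rewrite mdeg1 mdeg0.
Qed.

End RegularSequence.

Section InitialIdeal.
Variables (K : fieldType) (n : nat).
Hypothesis n2 : (2 < n)%N.
Notation S := {mpoly K[n * n]}.
Notation var := ('I_n * 'I_n)%type.
Notation X := (generic_mx K n).
Notation Y := (Ymx K n).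
Variable r : var -> nat.
Hypotheses (r_inj : injective r)
  (r_VW : forall v w, inV n v -> ~~ inV n w -> (r v < r w)%N).

Lemma initial_ideal_ideal J : is_ideal (initial_ideal K n r J).
Proof.
split.
- have f0 (T : Type) : 'I_0 -> T by case.
  by exists 0%N, (f0 _), (f0 _), (f0 _); split; [case | rewrite big_ord0].
- move=> a b [L1 [f1 [m1 [c1 [H1 ->]]]]] [L2 [f2 [m2 [c2 [H2 ->]]]]].
  pose glue (T : Type) (g1 : 'I_L1 -> T) (g2 : 'I_L2 -> T) k :=
    match split k with inl i => g1 i | inr j => g2 j end.
  exists (L1 + L2)%N, (glue _ f1 f2), (glue _ m1 m2), (glue _ c1 c2); split.
    by move=> k; rewrite /glue; case: split => i; [exact: H1 | exact: H2].
  rewrite big_split_ord /=; congr (_ + _); apply: eq_bigr => k _; rewrite /glue.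
    by rewrite (unsplitK (inl _ k)).
  by rewrite (unsplitK (inr _ k)).
- move=> e a [L [f [m [c [H ->]]]]].
  exists L, f, m, (fun k => e * c k); split=> //.
  by rewrite mulr_sumr; apply: eq_bigr => k _; rewrite mulrA.
Qed.

Definition choice_var (j i k : 'I_n) : var :=
  if cyc_choice j i k then super_var k else diag_var k.

Definition adj_mon (j i : 'I_n) : 'X_{1..n * n} :=
  (\sum_(k | k != i) U_(vidx n (choice_var j i k)))%MM.

Lemma choice_var1 j i k : (choice_var j i k).1 = k.
Proof. by rewrite /choice_var; case: ifP. Qed.

Lemma inV_choice j i k : inV n (choice_var j i k).
Proof. by rewrite /choice_var; case: ifP => _; [exact: inV_super | exact: inV_diag]. Qed.

Lemma adj_monE j i v : adj_mon j i (vidx n v) = (v.1 != i) && (v == choice_var j i v.1) :> nat.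
Proof.
rewrite /adj_mon mnm_sumE; under eq_bigr => k _ do rewrite mnm1E (inj_eq (@vidx_inj n)).
case: (eqVneq v.1 i) => [vi|vi] /=.
  rewrite big1 // => k ki; apply/eqP; rewrite eqb0; apply/negP => /eqP E.
  by move: ki; rewrite -vi -E choice_var1 eqxx.
rewrite (bigD1 v.1) //= big1 ?addn0 1?eq_sym // => k /andP[_ kv].
apply/eqP; rewrite eqb0; apply: contraNneq kv => E.
by rewrite -E choice_var1.
Qed.

Lemma adj_Ymx_mon j i : exists2 c : K, c != 0 & \adj Y j i = c *: 'X_[adj_mon j i].
Proof.
exists (\prod_(k | k != i) (if cyc_choice j i k then -1 else 1)).
  by apply/prodf_neq0 => k _; case: ifP; rewrite ?oppr_eq0 oner_eq0.
rewrite (adj_Ymx K n2) mxE /adj_mon -mprodXE -mul_mpolyC (rmorph_prod (@mpolyC (n * n) K)) -big_split /=.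
apply: eq_bigr => k _; rewrite /choice_var; case: ifP => _; last by rewrite mpolyC1 mul1r.
by rewrite mpolyCN mpolyC1 mulN1r.
Qed.

Lemma adj_mon_avoids j i : avoids (@inW n) (adj_mon j i).
Proof.
apply/forallP => x; have [v <-] := vidx_surj x; rewrite inW_vidx; apply/implyP => nV.
rewrite adj_monE eqb0; apply/negP => /andP[_ /eqP E].
by move: nV; rewrite E inV_choice.
Qed.

Lemma adj_ideal_Ymx_mon j i : adj_ideal Y 'X_[adj_mon j i].
Proof.
have [c c0 E] := adj_Ymx_mon j i.
have -> : 'X_[adj_mon j i] = c^-1%:MP * \adj Y j i.
  by rewrite E mul_mpolyC scalerA mulVf // scale1r.
apply: idealMl; [exact: adj_ideal_ideal | exact: adj_ideal_entry].
Qed.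

Lemma adj_ideal_Ymx_supp p m : adj_ideal Y p -> m \in msupp p ->
  exists j i, (adj_mon j i <= m)%MM.
Proof.
case=> Z ->; rewrite /mxtrace => /msupp_sum_le/flatten_mapP[j _].
rewrite mxE => /msupp_sum_le/flatten_mapP[i _].
have [c _ ->] := adj_Ymx_mon j i.
rewrite -scalerAl => /msuppZ_le; rewrite mulrC (perm_mem (msuppMX _ _)) => /mapP[m' _ ->].
by exists j, i; rewrite lem_addr.
Qed.

Lemma adj_ideal_YmxX m : adj_ideal Y 'X_[m] <-> exists j i, (adj_mon j i <= m)%MM.
Proof.
split=> [/adj_ideal_Ymx_supp|[j [i jm]]]; first by apply; rewrite msuppX inE eqxx.
rewrite -(submK jm) mpolyXD; apply: idealMl; first exact: adj_ideal_ideal.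
exact: adj_ideal_Ymx_mon.
Qed.

(** Setting W to zero leaves only the term at [adj_mon j i], so any other monomial contains a
    variable of W. The smallest variable where the two differ is then in W, where [adj_mon j i] has
    exponent 0. *)
Lemma adj_generic_lm j i : is_lm K n r (\adj X j i) (adj_mon j i).
Proof.
have kE : kill (@inW n) (\adj X j i) = \adj Y j i.
  have := map_mx_adj (kill (@inW n)) X => /matrixP/(_ j i); rewrite mxE => ->.
  by rewrite -(gen_mx_inW K n).
have [c c0 E] := adj_Ymx_mon j i.
have cE m : avoids (@inW n) m -> (\adj X j i)@_m = c * (adj_mon j i == m)%:R.
  move=> Wm; have := mcoeff_kill (@inW n) (\adj X j i) m.
  by rewrite Wm => <-; rewrite kE E mcoeffZ mcoeffX.
have mS : adj_mon j i \in msupp (\adj X j i).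
  by rewrite mcoeff_msupp cE ?adj_mon_avoids // eqxx mulr1.
have hX : \adj X j i \is (n.-1).-homog.
  by apply: homog_adj => a b; rewrite -gen_mx_pred0; exact: homog_gen_mx.
split=> // m' m'S m'm; right; split.
  by rewrite !(dhomog_mf hX).
have [w0] : exists w0, ~~ inV n w0 && (m' (vidx n w0) != 0%N).
  have : ~~ avoids (@inW n) m'.
    apply/negP => /cE E'; move: m'S; rewrite mcoeff_msupp E'.
    by case: (adj_mon j i =P m') => [/esym //|_]; rewrite mulr0 eqxx.
  rewrite negb_forall => /existsP[x]; have [w <-] := vidx_surj x.
  by rewrite negb_imply inW_vidx; exists w.
case/andP=> Ww0 m'w0.
have m0 w : ~~ inV n w -> adj_mon j i (vidx n w) = 0%N.
  move=> Ww; have /forallP/(_ (vidx n w)) := adj_mon_avoids j i.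
  by rewrite inW_vidx Ww => /eqP.
pose P w := adj_mon j i (vidx n w) != m' (vidx n w).
have Pw0 : P w0 by rewrite /P m0 // eq_sym.
case: (arg_maxnP r Pw0) => v Pv vmax.
have Wv : ~~ inV n v.
  by apply/negP => Vv; have := vmax _ Pw0; have := r_VW Vv Ww0; rewrite /=; lia.
exists v; split; first by rewrite m0 // lt0n; move: Pv; rewrite /P m0 // eq_sym.
move=> w vw; apply/eqP; rewrite -[_ == _]negbK; apply/negP => /vmax /=; lia.
Qed.

Lemma adj_ideal_trunc (U : pred 'I_(n * n)) p d : adj_ideal (gen_mx K U) p -> adj_ideal (gen_mx K U) (trunc d p).
Proof.
case=> Z ->; exists (map_mx (trunc (d - n.-1)) Z).
rewrite -(trunc_mulmxl _ _ (homog_adj (homog_gen_mx K U))) /mxtrace linear_sum.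
by apply: eq_bigr => i _; rewrite [in RHS]mxE.
Qed.

(** The part of [revlex_gt] that decides between monomials of equal degree, for use on a homogeneous
    component. *)
Definition revlex_top (p : S) (m : 'X_{1..n * n}) := forall m', m' \in msupp p -> m' <> m ->
  exists v, (m (vidx n v) < m' (vidx n v))%N /\
     forall w, (r v < r w)%N -> m (vidx n w) = m' (vidx n w).

Lemma kill_id_supp (U : pred 'I_(n * n)) (p : S) m : kill U p = p -> m \in msupp p -> avoids U m.
Proof.
move=> <-; rewrite mcoeff_msupp mcoeff_kill; by case: ifP => //; rewrite eqxx.
Qed.

(* Induction on the variables of W not yet set to zero, smallest first: either the
   smallest one divides the leading monomial, hence (revlex) the whole polynomial,
   and can be cancelled by regularity, or it can be set to zero. *)
Lemma revlex_top_adj_ideal (s : seq var) : forall (U : pred 'I_(n * n)) p m,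
  predU (mem (map (vidx n) s)) U =1 @inW n -> sorted (fun v w => r w <= r v)%N s ->
  adj_ideal (gen_mx K U) p -> kill U p = p -> m \in msupp p -> revlex_top p m ->
  adj_ideal Y 'X_[m].
Proof.
elim: s => [|v s IH] U p m HU srt.
  rewrite (eq_gen_mx K (V := @inW n)) ?(gen_mx_inW K n) // => Ip _ mp _.
  by apply/adj_ideal_YmxX/(adj_ideal_Ymx_supp Ip).
have [d le_md] := ubnP (mdeg m).
elim: d p m le_md => [p m|d IHd p m le_md Ip kp mp top]; first by rewrite ltn0 => /notF[].
have Wv : ~~ inV n v by rewrite -inW_vidx -HU /= inE eqxx.
have UW : subpred U (@inW n) by move=> i Ui; rewrite -HU /= Ui orbT.
have [m0|m0] := posnP (m (vidx n v)).
  pose U' : pred 'I_(n * n) := predU (pred1 (vidx n v)) U.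
  have kk : kill (pred1 (vidx n v)) p = kill U' p by rewrite -{1}kp kill_kill.
  apply: (IH U' (kill (pred1 (vidx n v)) p)).
  - by move=> i; rewrite -HU /= in_cons orbCA orbA.
  - exact: path_sorted srt.
  - exact: kill_adj_ideal.
  - by rewrite kk kill_idem.
  - rewrite mcoeff_msupp mcoeff_kill ifT -?mcoeff_msupp //.
    by apply/forallP => i; apply/implyP => /eqP ->; rewrite m0.
  - move=> m' m'p; apply: top; move: m'p; rewrite !mcoeff_msupp mcoeff_kill.
    by case: ifP => //; rewrite eqxx.
have k0 : kill (pred1 (vidx n v)) p = 0.
  apply/mpolyP => m'; rewrite mcoeff_kill mcoeff0; case: ifP => // /forallP/(_ (vidx n v)).
  rewrite /= eqxx => /eqP m'v; apply/eqP; rewrite mcoeff_eq0; apply/negP => m'p.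
  have m'm : m' <> m by move=> E; rewrite E in m'v; rewrite m'v in m0.
  have [v' [lt eqw]] := top _ m'p m'm.
  (* The deciding variable [v'] is not larger than [v], where the exponents differ; it is not [v],
     whose exponent drops from [m] to [m']; and smaller variables of W are already zero. *)
  case: (ltngtP (r v') (r v)) => [/eqw E|lt'|/r_inj E].
  - by rewrite E m'v in m0.
  - have Wv' : ~~ inV n v' by apply/negP => /r_VW/(_ Wv); lia.
    have := HU (vidx n v'); rewrite inW_vidx Wv' => /orP[v's|Uv'].
      have {v's} : vidx n v' \in map (vidx n) (v :: s) := v's.
      rewrite (mem_map (@vidx_inj n)) inE => /orP[/eqP E|v's]; first by rewrite E ltnn in lt'.
      have tr : transitive (fun v w => r w <= r v)%N by move=> b a c ab bc; exact: leq_trans bc ab.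
      have /allP/(_ _ v's) := order_path_min tr srt.
      lia.
    have /forallP/(_ (vidx n v')) := kill_id_supp kp m'p.
    by rewrite Uv' /=; move: lt; case: (m' _).
  - by rewrite E m'v in lt.
have [g pE] := kill1_split (vidx n v) p; rewrite k0 subr0 in pE.
have nUv : ~~ U (vidx n v).
  apply/negP => Uv; have /forallP/(_ (vidx n v)) := kill_id_supp kp mp.
  by rewrite Uv /=; move: m0; case: (m _).
have UvW : subpred (predU (pred1 (vidx n v)) U) (@inW n).
  by move=> i /orP[/eqP ->|/UW //]; rewrite inW_vidx.
have [ex1 _ _] := gn_gen_mx K n2 UvW.
rewrite -kill_gen_mx in ex1.
have Ig : adj_ideal (gen_mx K U) g by case: Ip => Z; rewrite pE => /(gn_ex1_regular ex1).
have kg : kill U g = g.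
  apply: (@mpolyXI K _ U_(vidx n v)%MM); rewrite -pE -[RHS]kp pE rmorphM /= killX.
  by rewrite (negbTE nUv).
have supp m' : (m' \in msupp g) = ((m' + U_(vidx n v))%MM \in msupp p).
  by rewrite pE mulrC !mcoeff_msupp addmC mcoeffMX.
have mK : (m - U_(vidx n v) + U_(vidx n v))%MM = m by rewrite submK // lep1mP -lt0n.
rewrite -mK mpolyXD; apply: idealMr; first exact: adj_ideal_ideal.
apply: (IHd g) => //.
- by have := congr1 (@mdeg _) mK; rewrite mdegD mdeg1; lia.
- by rewrite supp mK.
- move=> m' m'g m'm; have [||v' [lt eqw]] := top (m' + U_(vidx n v))%MM.
  + by rewrite -supp.
  + by move=> E; apply: m'm; rewrite -E addmK.
  exists v'; split; first by move: lt; rewrite -{1}mK !mnmDE ltn_add2r.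
  by move=> w /eqw; rewrite -{1}mK !mnmDE => /addIn.
Qed.

Lemma initial_idealE p : initial_ideal K n r (ideal_gen K n (minors K n X)) p <-> adj_ideal Y p.
Proof.
have n0 : (0 < n)%N by lia.
split=> [[L [f [m [c [H ->]]]]]|].
  apply: ideal_sum => [|k _]; first exact: adj_ideal_ideal.
  apply: idealMl; first exact: adj_ideal_ideal.
  have [/minors_adj_ideal-/(_ n0) Ifk [mS lm]] := H k.
  set g := f k in Ifk mS lm; set mk := m k in mS lm *; set d := mdeg mk.
  (* The component of [g] in the degree of its leading monomial. As a difference of truncations it
     stays in the ideal. *)
  pose gd := trunc d.+1 g - trunc d g.
  have gdE m' : gd@_m' = if mdeg m' == d then g@_m' else 0.
    rewrite /gd mcoeffB !mcoeff_mfilter ltnS leq_eqVlt; case: eqP => [->|_] /=.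
      by rewrite ltnn subr0.
    by rewrite subrr.
  pose s := sort (fun v w => r w <= r v)%N (enum [pred v | ~~ inV n v]).
  rewrite -(gen_mx_pred0 K n) in Ifk.
  apply: (@revlex_top_adj_ideal s pred0 gd).
  - move=> i /=; rewrite orbF; have [v <-] := vidx_surj i.
    by rewrite (mem_map (@vidx_inj n)) mem_sort mem_enum inE inW_vidx.
  - by apply: sort_sorted => v w; exact: leq_total.
  - by apply: idealB; [exact: adj_ideal_ideal | exact: adj_ideal_trunc | exact: adj_ideal_trunc].
  - by apply/mpolyP => m'; rewrite mcoeff_kill ifT //; apply/forallP.
  - by rewrite mcoeff_msupp gdE eqxx -mcoeff_msupp.
  - move=> m'; rewrite mcoeff_msupp gdE; case: (mdeg m' =P d) => [E|_]; last by rewrite eqxx.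
    rewrite -mcoeff_msupp => m'S m'm; case: (lm _ m'S m'm) => [|[_ //]].
    by rewrite E ltnn.
apply: adj_ideal_min; first exact: initial_ideal_ideal.
move=> j i; have [c _ ->] := adj_Ymx_mon j i.
exists 1%N, (fun _ => \adj X j i), (fun _ => adj_mon j i), (fun _ => c%:MP); split.
  move=> _; split; last exact: adj_generic_lm.
  by apply/minors_adj_ideal => //; exact: adj_ideal_entry.
by rewrite big_ord1 mul_mpolyC.
Qed.

Lemma sqfree_adj_mon j i : sqfree n (adj_mon j i).
Proof. by apply/forallP => x; have [v <-] := vidx_surj x; rewrite adj_monE; case: (_ && _). Qed.

Lemma adj_ideal_Ymx_sqfree J : (forall p, J p <-> adj_ideal Y p) -> sqfree_monomial_ideal K n J.
Proof.
move=> JE; exists [seq adj_mon ji.1 ji.2 | ji <- enum [set: 'I_n * 'I_n]]; split.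
  by apply/allP => m /mapP[[j i] _ ->]; exact: sqfree_adj_mon.
move=> p; rewrite JE; split.
  apply: adj_ideal_min; first exact: ideal_gen_ideal.
  move=> j i; have [c _ ->] := adj_Ymx_mon j i; rewrite -mul_mpolyC.
  apply: idealMl; first exact: ideal_gen_ideal.
  by apply/mem_ideal_gen/map_f/(map_f (fun ji => adj_mon ji.1 ji.2) (x := (j, i))); rewrite mem_enum inE.
apply: ideal_gen_min; first exact: adj_ideal_ideal.
by move=> _ /mapP[_ /mapP[[j i] _ ->] ->]; exact: adj_ideal_Ymx_mon.
Qed.

Lemma sqmonE (F : {set var}) : sqmon K n F = 'X_[\sum_(v in F) U_(vidx n v)].
Proof. by rewrite -mprodXE. Qed.

Lemma adj_ideal_Ymx_sqmon F : adj_ideal Y (sqmon K n F) <->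
  exists j i, forall k, k != i -> choice_var j i k \in F.
Proof.
have FE v : (\sum_(w in F) U_(vidx n w))%MM (vidx n v) = (v \in F) :> nat.
  rewrite mnm_sumE; under eq_bigr => w _ do rewrite mnm1E (inj_eq (@vidx_inj n)).
  case: (boolP (v \in F)) => vF.
    by rewrite (bigD1 v) //= eqxx big1 ?addn0 // => w /andP[_ /negbTE ->].
  by rewrite big1 // => w wF; case: eqP => // E; rewrite -E wF in vF.
rewrite sqmonE adj_ideal_YmxX; split=> -[j [i H]]; exists j, i.
  move=> k ki; have /mnm_lepP/(_ (vidx n (choice_var j i k))) := H.
  by rewrite adj_monE FE choice_var1 ki eqxx /=; case: (_ \in _).
apply/mnm_lepP => x; have [v <-] := vidx_surj x; rewrite adj_monE FE.
case: (boolP (_ && _)) => // /andP[vi /eqP E].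
by rewrite E H ?choice_var1 // -choice_var1 -E.
Qed.

End InitialIdeal.

(** * Faces of cyclic polytopes *)

(** The sum is the coefficient of degree [#|A| - 1] in the Lagrange interpolation of [p] at [A],
    which is [p] itself, of smaller degree. *)
Lemma divided_difference (R : fieldType) (I : finType) (x : I -> R) (A : {set I}) (p : {poly R}) :
  injective x -> (size p < #|A|)%N ->
  \sum_(i in A) p.[x i] / \prod_(j in A | j != i) (x i - x j) = 0.
Proof.
move=> x_inj szp; pose w i := \prod_(j in A | j != i) (x i - x j).
pose l i : {poly R} := \prod_(j in A | j != i) ('X - (x j)%:P).
have w0 i : w i != 0.
  by apply/prodf_neq0 => j /andP[_ ji]; rewrite subr_eq0 (inj_eq x_inj) eq_sym.
have szl i : i \in A -> size (l i) = #|A|.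
  move=> iA; rewrite /l -big_filter size_prod_XsubC size_filter -sum1_count.
  rewrite (cardD1 i (mem A)) iA add1n -sum1_card; congr _.+1.
  by apply: eq_bigl => j; rewrite !inE andbC.
pose q := \sum_(i in A) (p.[x i] / w i) *: l i.
have pq : p = q.
  apply/eqP; rewrite -subr_eq0; apply/eqP.
  apply: (@roots_geq_poly_eq0 _ _ [seq x i | i <- enum A]).
  - apply/allP => _ /mapP[i + ->]; rewrite mem_enum => iA.
    rewrite rootE hornerD hornerN horner_sum (bigD1 i) //= big1 ?addr0.
      rewrite hornerZ horner_prod; under eq_bigr => j _ do rewrite hornerXsubC.
      by rewrite divfK ?subrr.
    move=> j /andP[jA ji]; rewrite hornerZ horner_prod (bigD1 i) /= ?iA 1?eq_sym //.
    by rewrite hornerXsubC subrr mul0r mulr0.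
  - by rewrite map_inj_uniq // enum_uniq.
  - rewrite size_map -cardE (leq_trans (size_polyD _ _)) // geq_max (ltnW szp) size_polyN.
    apply: (leq_trans (size_sum _ _ _)); apply/bigmax_leqP => i iA.
    by rewrite (leq_trans (size_scale_leq _ _)) // szl.
have := congr1 (fun s : {poly R} => s`_(#|A|.-1)) pq.
rewrite nth_default; last by rewrite -ltnS (ltn_predK szp).
rewrite coef_sum => H; rewrite [RHS]H; apply: eq_bigr => i iA.
have /monicP : l i \is monic by apply: monic_prod => j _; exact: monicXsubC.
by rewrite coefZ lead_coefE (szl i iA) => ->; rewrite mulr1.
Qed.

Section CyclicPolytope.
Variables (R : realFieldType) (N : nat).
Implicit Types (i g : 'I_N) (F T : {set 'I_N}).

Let x i : R := (i.+1)%:R.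

Lemma moment_inj : injective x.
Proof. by move=> i j /eqP; rewrite eqr_nat eqSS => /eqP /val_inj. Qed.

(** On the moment curve, a functional minus its maximum is a polynomial in the parameter,
    nonconstant exactly when the functional is nonzero. *)
Lemma cyc_bd_faceP d F : cyc_bd_face R N d F <-> exists p : {poly R},
  [/\ (1 < size p <= d.+1)%N, forall i, i \in F -> p.[x i] = 0
    & forall i, i \notin F -> p.[x i] < 0].
Proof.
split=> [[c [b [c0 H]]]|[p [/andP[sz1 szd] pF pNF]]].
  pose p := \poly_(k < d.+1) (if k is k'.+1 then (if insub k' is Some l then c 0 l else 0) else - b).
  have pE i : p.[x i] = \sum_(k < d) c 0 k * ((i : nat).+1%:R) ^+ (k : nat).+1 - b.
    rewrite horner_poly big_ord_recl /= expr0 mulr1 addrC; congr (_ + _).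
    by apply: eq_bigr => k _; rewrite /bump /= add1n valK.
  exists p; split; last 2 first.
  - by move=> i /(H i).1 E; rewrite pE E subrr.
  - by move=> i /(H i).2 E; rewrite pE subr_lt0.
  rewrite size_poly andbT ltnNge; apply/negP => /size1_polyC pC.
  case/eqP: c0; apply/matrixP => a k; rewrite ord1 mxE.
  have := coef_poly d.+1 (fun k => if k is k'.+1 then (if insub k' is Some l then c 0 l else 0) else - b) k.+1.
  by rewrite -/p ltnS ltn_ord valK pC coefC.
exists (\row_(k < d) p`_k.+1), (- p`_0).
have pE i : \sum_(k < d) (\row_(k < d) p`_k.+1) 0 k * ((i : nat).+1%:R) ^+ (k : nat).+1 = p.[x i] - p`_0.
  rewrite (horner_coef_wide _ szd) big_ord_recl expr0 mulr1 addrC addrA addNr add0r.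
  by apply: eq_bigr => k _; rewrite mxE.
split.
  apply/eqP => /matrixP E; have : lead_coef p = 0.
    rewrite lead_coefE; case: (size p) sz1 szd => [|[|s]] //= _ sd.
    by have := E 0 (Ordinal (sd : (s < d)%N)); rewrite !mxE.
  by move/eqP; rewrite lead_coef_eq0 => /eqP p0; rewrite p0 size_poly0 in sz1.
move=> i; rewrite pE; split=> [/pF ->|/pNF]; first by rewrite sub0r.
by move=> H; rewrite -[X in _ < X]add0r ltrD2r.
Qed.

Definition stable T := [disjoint T & [set ordS g | g in T]].

(** The quadratic with roots at [g] and its successor is positive at the other vertices, except for
    the last [g]: its roots are then the extreme parameters, with all others in between. *)
Let sgn g : R := if g.+1 == N then -1 else 1.

Lemma moment_lt (i j : 'I_N) : (i < j)%N -> x i < x j.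
Proof. by move=> ij; rewrite ltr_nat ltnS. Qed.

Lemma sgn_pair g u : u != g -> u != ordS g -> 0 < sgn g * ((x u - x g) * (x u - x (ordS g))).
Proof.
move=> ug uS; have {}ug : (u : nat) != g by rewrite val_eqE.
have {uS} : (u : nat) != ordS g by rewrite val_eqE.
rewrite /sgn; have : (ordS g : nat) = _ := val_ordS g; case: eqP => [gN|gN] Sg uS.
  have Su : (ordS g < u)%N by lia.
  have ug' : (u < g)%N by have := ltn_ord u; lia.
  by rewrite mulN1r oppr_gt0 nmulr_rlt0 ?subr_gt0 ?subr_lt0 moment_lt.
rewrite mul1r; case: (ltngtP u g) => [lt|gt|E]; last by rewrite E eqxx in ug.
  by rewrite nmulr_rgt0 ?subr_lt0 moment_lt //; lia.
by rewrite pmulr_rgt0 ?subr_gt0 moment_lt //; lia.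
Qed.

Lemma sgn_own g : (1 < N)%N -> 0 < sgn g * (x (ordS g) - x g).
Proof.
move=> N1; rewrite /sgn; have : (ordS g : nat) = _ := val_ordS g; case: eqP => [gN|gN] Sg.
  by rewrite mulN1r opprB subr_gt0 moment_lt; lia.
by rewrite mul1r subr_gt0 moment_lt; lia.
Qed.

(* T and its cyclic shift alternate on the moment curve, so the coefficients of the
   divided difference on their union have constant sign on the shift: a functional
   that is maximal on T then vanishes on the whole union. *)
Lemma stable_not_face T F d : (1 < N)%N -> stable T -> T \subset F -> (d.+1 < #|T| + #|T|)%N ->
  ~ cyc_bd_face R N d F.
Proof.
move=> N1 stT TF dT /cyc_bd_faceP[p [/andP[sz1 szd] pF pNF]].
pose ST := [set ordS g | g in T]; pose A := T :|: ST.
have dis : T :&: ST = set0 by apply/eqP; rewrite setI_eq0.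
have cA : #|A| = (#|T| + #|T|)%N.
  by rewrite cardsU dis cards0 subn0 card_imset //; exact: (@ordS_inj N).
have ple i : p.[x i] <= 0.
  by case: (boolP (i \in F)) => [/pF ->|/pNF /ltW].
have pT g : g \in T -> p.[x g] = 0 by move/(subsetP TF)/pF.
have szA : (size p < #|A|)%N by rewrite cA (leq_ltn_trans szd).
have := divided_difference moment_inj szA.
rewrite (big_setID T) /= (setIidPr (subsetUl _ _)) big1 ?add0r; last first.
  by move=> g /pT ->; rewrite mul0r.
have -> : A :\: T = ST by rewrite setDUl setDv set0U; apply/setDidPl; rewrite disjoint_sym.
rewrite big_imset /=; last by move=> ? ? _ _; exact: (@ordS_inj N).
pose E := \prod_(g in T) sgn g.
have STN g : g \in T -> ordS g \notin T.
  move=> gT; apply/negP => SgT; have : ordS g \in T :&: ST by rewrite inE SgT imset_f.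
  by rewrite dis inE.
(* The factors group into [x (ordS g) - x g] and, for each other [h], the pair at [h] and [ordS h].
   Each group times its [sgn] is positive, so all weights have the sign of [E]. *)
have wpos g : g \in T -> 0 < E * \prod_(j in A | j != ordS g) (x (ordS g) - x j).
  move=> gT.
  have -> : \prod_(j in A | j != ordS g) (x (ordS g) - x j) = (x (ordS g) - x g) *
      \prod_(h in T | h != g) ((x (ordS g) - x h) * (x (ordS g) - x (ordS h))).
    rewrite (eq_bigl (fun j => j \in A :\ ordS g)); last by move=> j; rewrite !inE andbC.
    rewrite (big_setID T) /=.
    have -> : (A :\ ordS g) :&: T = T.
      apply/setIidPr/subsetP => h hT; rewrite !inE hT andbT.
      by apply: contraNneq (STN g gT) => <-.
    have -> : (A :\ ordS g) :\: T = [set ordS h | h in T :\ g].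
      apply/setP => h; apply/idP/imsetP => [|[k]].
        rewrite !inE => /and3P[hT hg /orP[hT'|/imsetP[k kT hk]]]; first by rewrite hT' in hT.
        by exists k; rewrite // !inE kT andbT; apply: contraNneq hg => <-; rewrite hk.
      rewrite !inE => /andP[kg kT] ->.
      by rewrite STN // (inj_eq (@ordS_inj N)) kg imset_f // orbT.
    rewrite big_imset /=; last by move=> ? ? _ _; exact: (@ordS_inj N).
    rewrite (bigD1 g gT) /= big_split /= mulrA; congr (_ * _).
    by apply: eq_bigl => h; rewrite !inE andbC.
  rewrite /E (bigD1 g gT) /= mulrACA -big_split /=; apply: mulr_gt0; first exact: sgn_own.
  apply: prodr_gt0 => h /andP[hT hg]; apply: sgn_pair; last by rewrite (inj_eq (@ordS_inj N)) eq_sym.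
  by apply: contraNneq (STN g gT) => ->.
move=> sum0.
have p0 g : g \in T -> p.[x (ordS g)] = 0.
  move=> gT; have E0 : E != 0.
    by apply/prodf_neq0 => h _; rewrite /sgn; case: ifP => _; rewrite ?oppr_eq0 oner_eq0.
  pose F' h := - (p.[x (ordS h)] / (E * \prod_(j in A | j != ordS h) (x (ordS h) - x j))).
  have /psumr_eq0P : forall h, h \in T -> 0 <= F' h.
    move=> h hT; rewrite /F' oppr_ge0 pmulr_lle0 ?invr_gt0 ?wpos //.
  have sF : \sum_(h in T) F' h = 0.
    rewrite sumrN -[RHS]oppr0; congr (- _); rewrite -[RHS](mulr0 E^-1) -[in RHS]sum0 mulr_sumr.
    by apply: eq_bigr => h _; rewrite invfM mulrCA.
  move=> /(_ sF g gT) /eqP; rewrite oppr_eq0 mulf_eq0 invr_eq0 => /orP[/eqP //|].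
  by rewrite gt_eqF ?wpos.
have : p = 0.
  apply: (@roots_geq_poly_eq0 _ _ [seq x i | i <- enum A]).
  - apply/allP => _ /mapP[i + ->]; rewrite mem_enum inE rootE => /orP[/pT ->|/imsetP[g gT ->]].
      by rewrite eqxx.
    by rewrite p0.
  - by rewrite map_inj_uniq ?enum_uniq //; exact: moment_inj.
  - by rewrite size_map -cardE ltnW.
by move=> p00; rewrite p00 size_poly0 in sz1.
Qed.

Lemma cdist_ordSr (j k : 'I_N) : cdist j (ordS k) = (if ordS k == j then 0 else (cdist j k).+1)%N.
Proof.
have Sk : (ordS k : nat) = _ := val_ordS k.
have -> : (ordS k == j) = ((ordS k : nat) == j) by [].
rewrite !cdistE Sk; have := ltn_ord j; have := ltn_ord k.
by case: eqP => ?; case: eqP => ?; repeat case: leqP => ?; lia.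
Qed.

Lemma stableP T : reflect (forall a b, a \in T -> b \in T -> a != ordS b) (stable T).
Proof.
rewrite /stable; apply: (iffP idP) => [/disjointFl dis a b aT bT|H].
  by apply: contraTneq aT => ->; rewrite dis ?imset_f.
rewrite disjoint_subset; apply/subsetP => a aT; rewrite inE; apply/negP => /imsetP[b bT ab].
by have := H a b aT bT; rewrite ab eqxx.
Qed.

(* Walk around the cycle from i, greedily choosing every vertex of F whose
   predecessor has not been chosen. *)
Lemma stable_cover i F : (1 < N)%N -> i \notin F ->
  exists T, [/\ T \subset F, stable T & F \subset T :|: [set ordS g | g in T]].
Proof.
move=> N1 iF; pose Fk k := [set y in F | (cdist i y < k)%N].
suff H k : exists T, [/\ T \subset Fk k, stable T & Fk k \subset T :|: [set ordS g | g in T]].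
  have [T [TF sT FT]] := H N; exists T.
  have FkN : Fk N = F by apply/setP => y; rewrite inE cdist_lt andbT.
  by rewrite FkN in TF FT.
elim: k => [|k [T [TF sT FT]]].
  exists set0; split; first exact: sub0set.
    by apply/stableP => a b; rewrite inE.
  by apply/subsetP => y; rewrite inE ltn0 andbF.
have TF' : T \subset Fk k.+1.
  apply: (subset_trans TF); apply/subsetP => y; rewrite !inE => /andP[-> yk].
  exact: ltnW.
case: (pickP (fun y => (y \in F) && (cdist i y == k))) => [y /andP[yF /eqP yk]|nok]; last first.
  exists T; split=> //; apply: subset_trans FT; apply/subsetP => y; rewrite !inE ltnS leq_eqVlt.
  by case/andP=> yF; have := nok y; rewrite yF /= => ->.
have Fk1 : Fk k.+1 = y |: Fk k.
  apply/setP => z; rewrite !inE ltnS leq_eqVlt -yk (inj_eq (@cdist_inj _ i)).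
  by case: eqP => [->|]; rewrite ?yF.
case: (boolP (y \in [set ordS g | g in T])) => yS.
  by exists T; split=> //; rewrite Fk1 subUset FT sub1set inE yS orbT.
exists (y |: T); split.
- by rewrite subUset TF' andbT sub1set Fk1 inE set11.
- apply/stableP => a b; rewrite !in_setU1 => /orP[/eqP ->|aT] /orP[/eqP ->|bT].
  + by rewrite eq_sym ordS_neq.
  + by apply: contraNneq yS => ->; rewrite imset_f.
  (* The successor of [y] is either farther from [i] than all vertices chosen so far, or [i] itself,
     which is not in [F]. *)
  + apply: contraTneq aT => ->; apply/negP => /(subsetP TF); rewrite inE cdist_ordSr yk.
    by case: eqP => [->|]; rewrite ?(negbTE iF) //= ltnNge leqnSn andbF.
  + by move/stableP: sT; apply.
rewrite Fk1 subUset sub1set !inE eqxx /=; apply: (subset_trans FT).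
rewrite setUSS ?subsetUr // imsetS // subsetUr //.
Qed.

(** [F] is covered by a stable [T] and its successors. Each [g] in [T] gives a quadratic vanishing
    at [g] and [ordS g] if the latter is in [F], and doubly at [g] otherwise; minus their product
    has degree [2 #|T|]. *)
Lemma stable_face F d : (0 < d)%N -> (d.+1 < N)%N ->
  (forall T, stable T -> T \subset F -> (#|T| + #|T| <= d)%N) -> cyc_bd_face R N d F.
Proof.
move=> d0 dN H; have N1 : (1 < N)%N by lia.
(* If [F] were everything, covering all vertices but one would force [N - 1 <= 2 #|T| <= d]. *)
have [i iF] : exists i, i \notin F.
  apply/existsP; rewrite -negb_forall; apply/negP => /forallP full.
  pose i : 'I_N := Ordinal (ltnW N1).
  have [||T [TF sT /subset_leq_card]] := @stable_cover i (F :\ i) => //.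
    by rewrite !inE eqxx.
  have -> : F :\ i = [set~ i] by apply/setP => j; rewrite !inE full andbT.
  rewrite cardsC1 card_ord => le; have := H T sT (subset_trans TF (subsetDl _ _)).
  have := leq_trans le (leq_card_setU _ _); rewrite card_imset; last exact: (@ordS_inj N).
  by move=> le1 le2; have := leq_trans le1 le2; lia.
have [T [TF sT FT]] := stable_cover N1 iF.
have leT := H T sT TF.
(* An empty product would be constant; for empty [T], hence empty [F], [- 'X] is negative at all
   vertices. *)
apply/cyc_bd_faceP; have [T0|/set0Pn[g0 g0T]] := eqVneq T set0.
  exists (- 'X); rewrite size_polyN size_polyX; split=> // j.
    by move/(subsetP FT); rewrite T0 imset0 setU0 inE.
  by move=> _; rewrite hornerN hornerX oppr_lt0 ltr0n.
pose q g : {poly R} := if ordS g \in F then sgn g *: (('X - (x g)%:P) * ('X - (x (ordS g))%:P))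
  else ('X - (x g)%:P) * ('X - (x g)%:P).
have szq g : size (q g) = 3%N.
  rewrite /q; case: ifP => _; rewrite ?size_scale ?size_Mmonic ?monicXsubC ?polyXsubC_eq0 ?size_XsubC //.
  by rewrite /sgn; case: ifP; rewrite ?oppr_eq0 oner_eq0.
exists (- \prod_(g in T) q g); split.
- rewrite size_polyN size_prod; last by move=> g _; rewrite -size_poly_gt0 szq.
  rewrite (eq_bigr (fun _ => 3%N)) // sum_nat_const.
  have -> (c : nat) : ((c * 3).+1 - c = (c + c).+1)%N by lia.
  by rewrite !ltnS leT andbT addn_gt0 orbb; apply/card_gt0P; exists g0.
- move=> j jF; rewrite hornerN horner_prod.
  suff [g gT qj] : exists2 g, g \in T & (q g).[x j] = 0.
    by rewrite (bigD1 g) //= qj mul0r oppr0.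
  have := subsetP FT j jF; rewrite inE => /orP[jT|/imsetP[g gT jg]].
    by exists j => //; rewrite /q; case: ifP => _; rewrite ?hornerZ hornerM !hornerXsubC subrr mul0r ?mulr0.
  by exists g => //; rewrite /q -jg jF hornerZ hornerM !hornerXsubC subrr !mulr0.
move=> j jF; rewrite hornerN horner_prod oppr_lt0; apply: prodr_gt0 => g gT.
have jg : j != g by apply: contraNneq jF => ->; exact: (subsetP TF).
rewrite /q; case: ifP => SgF.
  rewrite hornerZ hornerM !hornerXsubC; apply: sgn_pair => //.
  by apply: contraNneq jF => ->.
rewrite hornerM !hornerXsubC -expr2 exprn_even_gt0 //= subr_eq0.
by rewrite (inj_eq (@moment_inj)).
Qed.

End CyclicPolytope.

(** * The core of the initial complex *)

Section Position.
Variable n : nat.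
Hypothesis n2 : (2 < n)%N.
Notation var := ('I_n * 'I_n)%type.

Lemma position_subproof (v : var) : ((v.1).*2 + (v.1 != v.2) < 2 * n)%N.
Proof. by have := ltn_ord v.1; case: (_ != _); lia. Qed.

(* Adjacent positions on the 2n-cycle are the entries of V sharing a row or a column. *)
Definition position (v : var) : 'I_(2 * n) := Ordinal (position_subproof v).

Lemma position_diag k : position (diag_var k) = k.*2 :> nat.
Proof. by rewrite /= eqxx addn0. Qed.

Lemma position_super k : position (super_var k) = k.*2.+1 :> nat.
Proof. by rewrite /= eq_sym (ordS_neq _ (ltnW n2)) addn1. Qed.

Lemma inV_cases v : inV n v -> v = diag_var v.1 \/ v = super_var v.1.
Proof. by rewrite inVE // => /orP[/eqP|/eqP]; [left | right]. Qed.

Lemma position_inj v w : inV n v -> inV n w -> position v = position w -> v = w.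
Proof.
move=> /inV_cases[->|->] /inV_cases[->|->] /(congr1 (@nat_of_ord _)); rewrite ?position_diag ?position_super => E.
- by congr diag_var; apply: val_inj => /=; lia.
- lia.
- lia.
- by congr super_var; apply: val_inj => /=; lia.
Qed.

Lemma position_surj (p : 'I_(2 * n)) : exists2 v, inV n v & position v = p.
Proof.
have h : (p./2 < n)%N by have := ltn_ord p; lia.
pose k := Ordinal h.
case: (boolP (odd p)) => op.
  exists (super_var k); first exact: inV_super.
  by apply: ord_inj; rewrite position_super /=; lia.
exists (diag_var k); first exact: inV_diag.
by apply: ord_inj; rewrite position_diag /=; lia.
Qed.

Lemma ordS_position_diag k : ordS (position (diag_var k)) = position (super_var k).
Proof.
apply: ord_inj; rewrite position_super [LHS]val_ordS position_diag.
by have := ltn_ord k; case: eqP => //; lia.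
Qed.

Lemma ordS_position_super k : ordS (position (super_var k)) = position (diag_var (ordS k)).
Proof.
apply: ord_inj; rewrite position_diag [LHS]val_ordS position_super.
have -> : (ordS k : nat) = _ := val_ordS k.
by have := ltn_ord k; case: eqP; case: eqP; lia.
Qed.

Lemma choice_var_diag (j i k : 'I_n) : (choice_var j i k == diag_var k) = ~~ cyc_choice j i k.
Proof.
by rewrite /choice_var; case: ifP; rewrite ?eqxx // eq_sym (negbTE (diag_neq_super n2 _ _)).
Qed.

Definition gen_positions (j i : 'I_n) : {set 'I_(2 * n)} :=
  [set position (choice_var j i k) | k in [set~ i]].

Lemma position_choice_inj j i : injective (fun k => position (choice_var j i k)).
Proof.
move=> k l /(position_inj (inV_choice n2 _ _ _) (inV_choice n2 _ _ _)) E.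
by rewrite -(choice_var1 j i k) E choice_var1.
Qed.

Lemma card_gen_positions j i : #|gen_positions j i| = n.-1.
Proof. by rewrite card_imset ?cardsC1 ?card_ord //; exact: position_choice_inj. Qed.

(** Superdiagonal rows run from [j] to the row before [i], so a superdiagonal entry adjacent to the
    next diagonal one would need the omitted row [i]. *)
Lemma stable_gen_positions j i : stable (gen_positions j i).
Proof.
apply/stableP => _ _ /imsetP[k + ->] /imsetP[l + ->]; rewrite !inE => ki li.
apply/eqP; rewrite {2}/choice_var; case: ifP => cl.
  rewrite ordS_position_super => /(position_inj (inV_choice n2 _ _ _) (inV_diag n2 _)) E.
  have kE : k = ordS l by rewrite -(choice_var1 j i k) E.
  have := choice_var_diag j i k; rewrite E kE eqxx /cyc_choice => /esym.
  move: cl; rewrite /cyc_choice cdist_ordSr.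
  have : cdist j (ordS l) != cdist j i by rewrite (inj_eq (@cdist_inj _ j)) -kE.
  by rewrite cdist_ordSr => /eqP; case: eqP => _ ne lt; rewrite -leqNgt => ?; lia.
rewrite ordS_position_diag => /(position_inj (inV_choice n2 _ _ _) (inV_super n2 _)) E.
have kE : k = l by rewrite -(choice_var1 j i k) E.
have := choice_var_diag j i k; rewrite E kE eq_sym (negbTE (diag_neq_super n2 _ _)).
by rewrite cl.
Qed.

(* Reading T from the row i that it misses, once a superdiagonal entry is used the
   diagonal ones are excluded; j is the row where the switch occurs. *)
Lemma stable_gen_positionsP (T : {set 'I_(2 * n)}) : stable T -> #|T| = n.-1 ->
  exists j i, T = gen_positions j i.
Proof.
move=> /stableP sT cT.
pose a k := position (diag_var k) \in T; pose b k := position (super_var k) \in T.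
have nab k : a k -> b k -> false.
  by move=> ak bk; have := sT _ _ bk ak; rewrite ordS_position_diag eqxx.
have nba k : b k -> a (ordS k) -> false.
  by move=> bk ak; have := sT _ _ ak bk; rewrite ordS_position_super eqxx.
have half_lt (p : 'I_(2 * n)) : (p./2 < n)%N by have := ltn_ord p; lia.
pose half p := Ordinal (half_lt p).
have half_cases p : p \in T -> position (diag_var (half p)) = p /\ a (half p) \/
    position (super_var (half p)) = p /\ b (half p).
  move=> pT; have [v Vv vp] := position_surj p.
  have : half p = v.1.
    apply: ord_inj; rewrite /= -vp; case: (inV_cases Vv) => ->; rewrite ?position_diag ?position_super /=; lia.
  rewrite /a /b => ->; case: (inV_cases Vv) => E; [left | right]; by rewrite -E vp.
have half_inj : {in T &, injective half}.
  move=> p q pT qT pq; case: (half_cases p pT); case: (half_cases q qT); rewrite pq => -[Eq aq] [Ep ap].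
  - by rewrite -Ep.
  - by have := nab _ ap aq.
  - by have := nab _ aq ap.
  - by rewrite -Ep.
have cH : #|half @: T| = n.-1 by rewrite card_in_imset.
have [i iH] : exists i, i \notin half @: T.
  apply/existsP; rewrite -negb_forall; apply/negP => /forallP full.
  have E : half @: T = setT by apply/setP => k; rewrite full inE.
  by move: cH; rewrite E cardsT card_ord; lia.
have HE : half @: T = [set~ i].
  apply/eqP; rewrite eqEcard cH cardsC1 card_ord leqnn andbT.
  by apply/subsetP => k kH; rewrite !inE; apply: contraNneq iH => <-.
have ab k : k != i -> a k || b k.
  move=> ki; have : k \in half @: T by rewrite HE !inE.
  by case/imsetP=> p pT ->; case: (half_cases p pT) => -[_ ->]; rewrite ?orbT.
have mono m : forall k l, k != i -> l != i -> cdist i l = (cdist i k + m)%N -> b k -> b l.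
  elim: m => [|m IH] k l ki li E bk.
    by rewrite addn0 in E; rewrite (cdist_inj E).
  have Ski : ordS k != i.
    apply/eqP => Ski.
    have : cdist (ordS k) k = n.-1 by rewrite cdist_ordS eqxx.
    by rewrite Ski; have := cdist_lt i l; lia.
  have bS : b (ordS k) by case/orP: (ab _ Ski) => // /(nba _ bk).
  apply: (IH (ordS k)) => //; rewrite cdist_ordSr (negbTE Ski); lia.
pose P k := (k != i) && b k.
(* [j] is the first superdiagonal row met from [i]; if there is none, [j = i] selects the diagonal
   everywhere. *)
have [j jP] : exists j, forall k, k != i -> cyc_choice j i k = b k.
  case: (pickP P) => [k0 Pk0|noP]; last first.
    exists i => k ki; rewrite /cyc_choice cdistnn // ltn0.
    by have := noP k; rewrite /P ki => /= ->.
  case: (arg_minnP (cdist i) Pk0) => j /andP[ji bj] jmin; exists j => k ki.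
  have -> : cyc_choice j i k = (cdist i j <= cdist i k)%N.
    have kn : (k : nat) != i by [].
    have jn : (j : nat) != i by [].
    have [] := (ltn_ord i, ltn_ord j, ltn_ord k) => -[ti tj] tk.
    rewrite /cyc_choice !cdistE; case: (leqP j k) => ?; case: (leqP j i) => ?;
      case: (leqP i j) => ?; case: (leqP i k) => ?; apply/idP/idP => ?; lia.
  apply/idP/idP => [le|bk]; last by apply: jmin; rewrite /P ki.
  by apply: (mono (cdist i k - cdist i j)%N j k) => //; rewrite subnKC.
exists j, i; apply/eqP; rewrite eq_sym eqEcard cT card_gen_positions leqnn andbT.
apply/subsetP => _ /imsetP[k + ->]; rewrite !inE => ki; rewrite /choice_var jP //.
by case: ifP => bk //; move: (ab k ki); rewrite bk orbF.
Qed.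

Lemma gen_positions_subset (F : {set var}) j i : (forall v, v \in F -> inV n v) ->
  (gen_positions j i \subset position @: F) <-> (forall k, k != i -> choice_var j i k \in F).
Proof.
move=> VF; split=> [H k ki|H].
  have /(subsetP H)/imsetP[v vF E] : position (choice_var j i k) \in gen_positions j i.
    by apply: imset_f; rewrite !inE.
  by rewrite (position_inj (inV_choice n2 j i k) (VF _ vF) E).
by apply/subsetP => _ /imsetP[k + ->]; rewrite !inE => ki; apply/imset_f/H.
Qed.

Variables (K : fieldType) (J : {mpoly K[n * n]} -> Prop).
Hypothesis JE : forall p, J p <-> adj_ideal (Ymx K n) p.

(** Boolean, so that a facet above a given face comes from [maxset_exists]. *)
Let nonface (F : {set var}) := [exists j, exists i, [forall k, (k != i) ==> (choice_var j i k \in F)]].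

Lemma sr_faceE F : sr_face K n J F <-> ~~ nonface F.
Proof.
rewrite /sr_face JE (adj_ideal_Ymx_sqmon K n2); split=> [H|/negP H [j [i Hji]]].
  apply/negP => /existsP[j /existsP[i /forallP Hji]]; apply: H; exists j, i => k ki.
  by have := Hji k; rewrite ki.
apply: H; apply/existsP; exists j; apply/existsP; exists i; apply/forallP => k.
by apply/implyP; exact: Hji.
Qed.

Lemma nonfaceS (F G : {set var}) : F \subset G -> nonface F -> nonface G.
Proof.
move=> /subsetP FG /existsP[j /existsP[i /forallP H]].
apply/existsP; exists j; apply/existsP; exists i; apply/forallP => k; apply/implyP => ki.
by apply: FG; have := H k; rewrite ki.
Qed.

Lemma nonface_card (F : {set var}) : nonface F -> (n.-1 <= #|F|)%N.
Proof.
case/existsP=> j /existsP[i /forallP H].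
rewrite -(card_gen_positions j i) /gen_positions (imset_comp position (choice_var j i)).
apply: (leq_trans (leq_imset_card _ _)); apply: subset_leq_card.
by apply/subsetP => _ /imsetP[k + ->]; rewrite !inE => ki; have := H k; rewrite ki.
Qed.

(** Variables of W occur in no generator, so every facet contains them. A variable of V lies in the
    support [G] of a generator; [G :\ v] is too small to be a nonface, and a facet containing it
    misses [v]. *)
Lemma core_vertexE v : core_vertex K n J v <-> inV n v.
Proof.
split=> [[_ [F [[faceF maxF] vF]]]|Vv].
  apply: contraNT vF => Wv.
  have <- : v |: F = F.
    apply: maxF; last exact: subsetUr.
    apply/sr_faceE; move/sr_faceE: faceF; apply: contra => /existsP[j /existsP[i /forallP H]].
    apply/existsP; exists j; apply/existsP; exists i; apply/forallP => k; apply/implyP => ki.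
    have := H k; rewrite ki in_setU1 /= => /orP[/eqP E|//].
    by move: Wv; rewrite -E inV_choice.
  by rewrite setU11.
split.
  by apply/sr_faceE/negP => /nonface_card; rewrite cards1; lia.
(* [j = i] makes all choices diagonal; taking for [i] the predecessor of [j] makes them all
   superdiagonal. *)
have [j [i [vi vE]]] : exists j i, v.1 != i /\ v = choice_var j i v.1.
  have [->|->] := inV_cases Vv; rewrite /=.
    exists (ordS v.1), (ordS v.1); rewrite eq_sym ordS_neq 1?ltnW //; split=> //.
    by rewrite /choice_var /cyc_choice cdistnn ltn0.
  exists v.1, (ord_pred v.1); split.
    by rewrite -{1}(ord_predK v.1) ordS_neq // ltnW.
  rewrite /choice_var ifT // /cyc_choice cdistnn //.
  by rewrite lt0n cdist_eq0 -{2}(ord_predK v.1) eq_sym ordS_neq // ltnW.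
pose G := [set choice_var j i k | k in [set~ i]].
have vG : v \in G by apply/imsetP; exists v.1; rewrite ?inE.
have nG : nonface G.
  apply/existsP; exists j; apply/existsP; exists i; apply/forallP => k; apply/implyP => ki.
  by apply: imset_f; rewrite !inE.
have faceG : ~~ nonface (G :\ v).
  apply/negP => /nonface_card; rewrite leqNgt => /negP; apply.
  have <- : #|G| = n.-1.
    rewrite card_in_imset ?cardsC1 ?card_ord // => k l _ _ /(congr1 fst).
    by rewrite !choice_var1.
  by rewrite (cardsD1 v G) vG.
have [F /maxsetP[faceF maxF] GF] := maxset_exists (P := fun F => ~~ nonface F) faceG.
exists F; split; first split; first exact/sr_faceE.
  by move=> G' /sr_faceE; exact: maxF.
apply: contraNN faceF => vF; apply: nonfaceS nG.
by rewrite -(setD1K vG) subUset sub1set vF.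
Qed.

Lemma core_iso (R : realFieldType) : core_iso_cyclic K n R J.
Proof.
exists position; split; last split.
- by move=> v w /core_vertexE Vv /core_vertexE Vw; exact: position_inj.
- by move=> i; have [v Vv <-] := position_surj i; exists v => //; exact/core_vertexE.
move=> F coreF; have VF v : v \in F -> inV n v by move/coreF/core_vertexE.
have -> : core_face K n J F <-> sr_face K n J F by split=> [[]|].
rewrite sr_faceE; split=> [nF|faceF].
  apply: stable_face; [lia | lia |] => T sT TF.
  (* The bound [2 #|T| <= 2n - 4] fails only from [n - 1] elements on, and any [n - 1] of them form
     a generator. *)
  case: (leqP #|T| n.-2) => [|lt]; first by lia.
  have [T' [T'T cT']] : exists T' : {set 'I_(2 * n)}, T' \subset T /\ #|T'| = n.-1.
    have : (0 < #|[set B : {set _} | (B \subset T) && (#|B| == n.-1)]|)%N.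
      by rewrite cards_draws bin_gt0; lia.
    by case/card_gt0P=> T'; rewrite inE => /andP[T'T /eqP]; exists T'.
  have sT' : stable T'.
    apply/stableP => a b aT bT; have /stableP := sT; apply; exact: (subsetP T'T).
  have [j [i TE]] := stable_gen_positionsP sT' cT'.
  case/negP: nF; apply/existsP; exists j; apply/existsP; exists i; apply/forallP => k; apply/implyP.
  move: k; apply/(gen_positions_subset j i VF); rewrite -TE.
  exact: subset_trans TF.
apply/negP => /existsP[j /existsP[i /forallP H]].
have TF : gen_positions j i \subset position @: F.
  by apply/(gen_positions_subset j i VF) => k ki; have := H k; rewrite ki.
apply: (stable_not_face _ (stable_gen_positions j i) TF _ faceF); first by lia.
by rewrite !card_gen_positions; lia.
Qed.

End Position.

Theorem theorem8p1 (K : fieldType) (n : nat) (hn : (2 < n)%N)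
  (r : 'I_n * 'I_n -> nat) (r_inj : injective r)
  (r_VW : forall v w, inV n v -> ~~ inV n w -> (r v < r w)%N)
  (R : realFieldType) :
  let I := ideal_gen K n (minors K n (generic_mx K n)) in
  let inI := initial_ideal K n r I in
  [/\ sqfree_monomial_ideal K n inI,
      same_graded_betti K n I inI,
      core_iso_cyclic K n R inI,
      regular_seq_mod K n (minors K n (generic_mx K n)) (Wvars K n) &
      (forall p, inI p <-> ideal_gen K n (minors K n (Ymx K n)) p)].
Proof.
move=> I inI; have n0 : (0 < n)%N by lia.
have inIE : forall p, inI p <-> adj_ideal (Ymx K n) p by exact: initial_idealE.
(* One statement serves both ideals, and the degrees do not depend on [U]. *)
have resolution (U : pred 'I_(n * n)) (J : {mpoly K[n * n]} -> Prop) : subpred U (@inW n) ->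
    (forall p, J p <-> adj_ideal (gen_mx K U) p) ->
    exists g D, min_graded_res K n J (gn_degrees n) g D.
  move=> UW JE; have [ex1 ex2 ex3] := gn_gen_mx K hn UW.
  apply: (gulliksen_negard_resolution (Ordinal n0) (ltnW hn) _ _ ex1 ex2 ex3 JE).
    exact: homog_gen_mx.
  exact: det_gen_mx_neq0.
split.
- exact: adj_ideal_Ymx_sqfree.
- have [||g1 [D1 res1]] := resolution pred0 I; first by [].
    by move=> p; rewrite gen_mx_pred0; exact: minors_adj_ideal.
  have [||g2 [D2 res2]] := resolution (@inW n) inI; first by [].
    by move=> p; rewrite gen_mx_inW; exact: inIE.
  by exists (gn_degrees n), g1, D1, (gn_degrees n), g2, D2.
- exact: core_iso.
- exact: regular_seq_W.
- by move=> p; rewrite inIE; symmetry; exact: minors_adj_ideal.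
Qed.
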